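(* Let $n\ge 4$ be an integer and for every integer $k$ with $2\le k\le \frac n2$ let $$\mathbf{Tri}(n,k;q):=q^{k(k-2)}\,\frac{[n]_q}{[k]_q}\begin{bmatrix} n-4\\ 2k-4\end{bmatrix}_q\mathbf{Cat}(k-2;q)\left(\sum_{j=0}^{n-2k}q^{j(n-2)}\begin{bmatrix} n-2k\\ j\end{bmatrix}_q\right).$$ Then $$\sum_{2\le k\le n/2}\mathbf{Tri}(n,k;q)=\mathbf{Cat}(n-2;q),$$ and for every integer $k$ with $2\le k\le \frac n2$ the triple $$\bigl(\mathrm{TRI}_{\mathrm{ear}}(n,k),\ \langle\mathrm{rot}_n\rangle,\ \mathbf{Tri}(n,k;q)\bigr)$$ exhibits the cyclic sieving phenomenon, where $\langle\mathrm{rot}_n\rangle$ is regarded as an action of the cyclic group of order $n$.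
   Context: Cyclic sieving: let $X$ be a finite set, $C_N$ a cyclic group of order $N$ with generator $g$ acting on $X$, and $f(q)$ a polynomial with non-negative integer coefficients. The triple $(X,C_N,f(q))$ exhibits the cyclic sieving phenomenon if for all $d\in\mathbb Z$, $|\{x\in X: g^d\cdot x=x\}|=f(\xi^d)$, where $\xi$ is a primitive $N$-th complex root of unity. $[m]_q=1+q+\dots+q^{m-1}$; $\begin{bmatrix} m\\ r\end{bmatrix}_q$ is the Gaussian $q$-binomial coefficient, equal to $0$ unless $m\ge r\ge 0$; $\mathbf{Cat}(m;q)=\frac{1}{[m+1]_q}\begin{bmatrix} 2m\\ m\end{bmatrix}_q$. $\mathrm{TRI}(n)$ is the set of triangulations of a regular $n$-gon with vertices labelled $1,\dots,n$ in cyclic order (in this statement the argument is the number of vertices of the polygon). An ear of a triangulation is formed by three cyclically consecutive vertices $i,i+1,i+2\pmod n$ that are pairwise adjacent in the triangulation. $\mathrm{TRI}_{\mathrm{ear}}(n,k)$ is the set of triangulations of the $n$-gon with exactly $k$ ears. $\mathrm{rot}_n$ acts by rotating a triangulation one step, $i\mapsto i+1\pmod n$. *)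

(* Defs.v *)
From HB Require Import structures.
From mathcomp Require Import all_boot all_order all_algebra all_fingroup.
From mathcomp Require Import all_field.
From mathcomp Require Import fraction.

Set Implicit Arguments.
Unset Strict Implicit.
Unset Printing Implicit Defensive.

Import Order.TTheory GRing.Theory Num.Theory.

Local Open Scope ring_scope.

(** * q-analogues, as elements of the field of rational functions in q *)

Definition ratfun : fieldType := {fraction {poly int}}.

Definition poly_ratfun (f : {poly int}) : ratfun := FracField.tofrac f.

Definition qvar : ratfun := poly_ratfun 'X.

Definition qint (m : nat) : ratfun := \sum_(i < m) qvar ^+ i.

Definition qfact (m : nat) : ratfun := \prod_(i < m) qint i.+1.

Definition qbinom (m r : nat) : ratfun :=
  if (r <= m)%N then qfact m / (qfact r * qfact (m - r)) else 0.

Definition qCat (m : nat) : ratfun := (qint m.+1)^-1 * qbinom (2 * m) m.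

(* The natural-number subtractions are exact for 2 <= k, 2 * k <= n, 4 <= n. *)
Definition qTri (n k : nat) : ratfun :=
  qvar ^+ (k * (k - 2)) * (qint n / qint k) * qbinom (n - 4) (2 * k - 4)
  * qCat (k - 2)
  * (\sum_(0 <= j < (n - 2 * k).+1) qvar ^+ (j * (n - 2)) * qbinom (n - 2 * k) j).

(** * Cyclic sieving *)

Definition expgz (gT : finGroupType) (g : gT) (d : int) : gT :=
  match d with Posz m => (g ^+ m)%g | Negz m => (g ^- m.+1)%g end.

(* The cyclic group is <[g]>; the action need not be faithful on X.
   All complex roots of unity lie in algC. *)
Definition cyclic_sieving (gT : finGroupType) (T : finType)
    (X : {set T}) (to : {action gT &-> T}) (g : gT) (N : nat)
    (f : {poly int}) : Prop :=
  [/\ #[g]%g = N,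
      [acts <[g]>%g, on X | to],
      forall i : nat, 0 <= f`_i
    & forall xi : algC, N.-primitive_root xi ->
      forall d : int,
        #|'Fix_(X | to)[expgz g d]%g|%:R = (map_poly intr f).[xi ^ d] ].

(** * Triangulations of the n-gon with vertex set 'I_n

    A chord is a two-element set of vertices; ordS is i |-> i + 1 mod n. *)

Definition is_side (n : nat) (e : {set 'I_n}) : bool :=
  [exists i : 'I_n, e == [set i; ordS i]].

Definition is_diagonal (n : nat) (e : {set 'I_n}) : bool :=
  (#|e| == 2) && ~~ is_side e.

(* Two chords meet in their interiors iff f has one endpoint strictly between
   the endpoints a < b of e, and the other one strictly outside of [a, b]. *)
Definition crossing (n : nat) (e f : {set 'I_n}) : bool :=
  [exists a in e, exists b in e, exists c in f, exists d in f,
     (a < c < b)%N && ((d < a)%N || (b < d)%N)].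

Definition noncrossing_diagonals (n : nat) (D : {set {set 'I_n}}) : bool :=
  [forall e in D, is_diagonal e]
  && [forall e in D, forall f in D, ~~ crossing e f].

(* A triangulation is given by its set of diagonals. *)
Definition TRI (n : nat) : {set {set {set 'I_n}}} :=
  [set D | maxset (@noncrossing_diagonals n) D].

Definition adjacent (n : nat) (D : {set {set 'I_n}}) (i j : 'I_n) : bool :=
  is_side [set i; j] || ([set i; j] \in D).

Definition is_ear (n : nat) (D : {set {set 'I_n}}) (t : {set 'I_n}) : bool :=
  [exists i : 'I_n,
     [&& t == [set i; ordS i; ordS (ordS i)],
         adjacent D i (ordS i),
         adjacent D (ordS i) (ordS (ordS i))
       & adjacent D i (ordS (ordS i))]].

Definition ears (n : nat) (D : {set {set 'I_n}}) : {set {set 'I_n}} :=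
  [set t | is_ear D t].

Definition TRI_ear (n k : nat) : {set {set {set 'I_n}}} :=
  [set D in TRI n | #|ears D| == k].

Definition rot_vertices (n : nat) : {perm 'I_n} := perm (@ordS_inj n).

(* The natural action of permutations of the vertices, lifted to sets of
   vertices and then to sets of chords. *)
Definition rot_action (n : nat) :
    {action {perm 'I_n} &-> {set {set 'I_n}}} :=
  ((('P)^*)^*)%act.

(* Main.v *)
From HB Require Import structures.
Require Import Defs.
From mathcomp Require Import all_boot all_order all_algebra all_fingroup.
From mathcomp Require Import all_solvable all_field.
From mathcomp Require Import fraction zify ring.

(** Notation in the comments: [m] is a q-integer, [m; r] a Gaussian binomial
    coefficient, K(n) = Cat(n-2) / [n], and H_s(x) = sum_j x^j [s; j] is the
    Rogers-Szego polynomial.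

    The sum formula.  Since K(k) = [2k-4]! / ([k]! [k-2]!), the rational
    function Tri(n, k) is [n] times the k-th summand of
      K(n) = sum_k q^(k(k-2)) [n-4; n-2k] K(k) H_(n-2k)(q^(n-2)).
    To prove this (tri_weight_rec), expand H and put p = k + j: for fixed p the
    sum over k is a q-Vandermonde sum, and then so is the sum over p.
    Multiplying by [n] gives the first assertion.

    Nonnegativity.  Read as a recursion, the same identity propagates
    positivity.  The only denominators of K are [2] and [3]: by strong
    induction, [2] K(n) has nonnegative coefficients if 3 does not divide n,
    and [2][3] K(n) and [6] K(n) have if it does (N_weight).  In Tri(n, k) the
    denominators of K(k) are cleared by [n] if n is even, except that the [3] is
    cleared by [n-4; n-2k] if 3 divides k but not n.  If n is odd, then H splits
    into the terms [n-2k-1; j] x^j (q^j + x), x = q^(n-2); for odd j the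
    Gaussian coefficient is divisible by [2], and for even j the product
    [n] (1 + q^c) with c = n-2-j odd can be regrouped into multiples of [2] and,
    if 3 divides both n and k, of [6] and [2][3] (N_gTri).

    The values at roots of unity.  Let z have order e and n = e m.  By the
    q-Lucas theorem, Tri(n, k) vanishes at z unless k = e c and e <= 3; for
    e = 1 its value is m (m-4)! 2^(m-2c) / ((m-2c)! c! (c-2)!), for e = 2, 3 it
    is m (m-2)! 2^(m-2c) / ((m-2c)! c! (c-1)!).

    The fixed points.  A triangulation with e-fold rotational symmetry has
    its ears in orbits of size e.  Cutting off one such orbit leaves an e-fold
    symmetric triangulation of a polygon with e fewer vertices, and gluing
    triangles onto an orbit of sides undoes this (graft, prune).  Counting
    pairs of a triangulation and an ear of it in two ways turns this bijection
    into a linear recursion in m and c for the number of e-fold symmetric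
    triangulations of the e m-gon with e c ears (sym_tri_rec).  The factorial
    expressions above satisfy it and have the right initial values.  For
    e >= 4 the descent ends at an e-gon invariant under rotation by one step;
    it has an ear, so two consecutive ears, but these would cross. *)

Set Implicit Arguments.
Unset Strict Implicit.
Unset Printing Implicit Defensive.

(** * Chords, crossings and ears *)

Lemma val_ordS n (i : 'I_n) :
  val (ordS i) = if (val i).+1 == n then 0 else (val i).+1.
Proof.
case: i => i lt_i /=; case: eqP => [->|ne]; first by rewrite modnn.
by rewrite modn_small //; lia.
Qed.

Lemma set2_eqE (T : finType) (a b c d : T) :
  ([set a; b] == [set c; d]) = ((a == c) && (b == d)) || ((a == d) && (b == c)).
Proof.
apply/eqP/idP => [E|/orP[] /andP[/eqP-> /eqP->] //]; last by rewrite setUC.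
have ha : a \in [set c; d] by rewrite -E set21.
have hb : b \in [set c; d] by rewrite -E set22.
have hc : c \in [set a; b] by rewrite E set21.
have hd : d \in [set a; b] by rewrite E set22.
move: ha hb hc hd; rewrite !inE.
by do 4!(case/orP => /eqP ?); subst; rewrite !eqxx ?orbT.
Qed.

(** On the line, betweenness is not invariant under rotation.  But carrying a or
    b past the cut negates it both for c and for d, so that the exclusive or in
    separate is invariant. *)
Definition between (a b c : nat) : bool := (a < c < b) || (b < c < a).

Definition separate (a b c d : nat) : bool :=
  [&& c != a, c != b, d != a, d != b & between a b c (+) between a b d].

Lemma crossing_set2 n (a b c d : 'I_n) :
  crossing [set a; b] [set c; d] = separate a b c d.
Proof.
apply/idP/idP.
  move=> /existsP[x /andP[+ /existsP[y /andP[+ /existsP[z /andP[+ /existsP[t]]]]]]].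
  rewrite !inE => /orP[]/eqP-> /orP[]/eqP-> /orP[]/eqP-> /andP[/orP[]/eqP->];
  rewrite /separate /between; lia.
move=> H.
have wit (x y z t : 'I_n) : x \in [set a; b] -> y \in [set a; b] ->
   z \in [set c; d] -> t \in [set c; d] -> (x < z < y) && ((t < x) || (y < t)) ->
   crossing [set a; b] [set c; d].
  move=> hx hy hz ht h; apply/existsP; exists x; rewrite hx.
  apply/existsP; exists y; rewrite hy; apply/existsP; exists z; rewrite hz.
  by apply/existsP; exists t; rewrite ht.
have [lab|lab] := boolP (a < b); have [hc|hc] := boolP (between a b c).
- by apply: (wit a b c d); rewrite ?set21 ?set22 //; move: H; rewrite /separate /between in hc *; lia.
- by apply: (wit a b d c); rewrite ?set21 ?set22 //; move: H; rewrite /separate /between in hc *; lia.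
- by apply: (wit b a c d); rewrite ?set21 ?set22 //; move: H; rewrite /separate /between in hc *; lia.
- by apply: (wit b a d c); rewrite ?set21 ?set22 //; move: H; rewrite /separate /between in hc *; lia.
Qed.

Lemma separate_sym a b c d : separate a b c d = separate c d a b.
Proof. rewrite /separate /between; lia. Qed.

Lemma separate_ordS n (a b c d : 'I_n) :
  separate (ordS a) (ordS b) (ordS c) (ordS d) = separate a b c d.
Proof.
have := ltn_ord a; have := ltn_ord b; have := ltn_ord c; have := ltn_ord d.
rewrite /separate /between.
move: (val_ordS a) (val_ordS b) (val_ordS c) (val_ordS d) => /= -> -> -> ->.
by case: ifP; case: ifP; case: ifP; case: ifP; lia.
Qed.

Lemma is_side_set2 n (a b : 'I_n) :
  is_side [set a; b] = (b == ordS a) || (a == ordS b).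
Proof.
apply/existsP/idP => [[i]|/orP[] /eqP->].
- rewrite set2_eqE => /orP[] /andP[/eqP-> /eqP->]; by rewrite eqxx ?orbT.
- by exists a.
- by exists b; rewrite setUC.
Qed.

Lemma is_diagonal_set2 n (a b : 'I_n) :
  is_diagonal [set a; b] = [&& a != b, b != ordS a & a != ordS b].
Proof.
by rewrite /is_diagonal is_side_set2 cards2 negb_or; case: (a == b).
Qed.

Lemma diagonal_set2 n (e : {set 'I_n}) : is_diagonal e ->
  exists a b : 'I_n, e = [set a; b].
Proof. by case/andP => /cards2P[a [b [_ ->]]] _; exists a, b. Qed.

Lemma crossing_sym n (e f : {set 'I_n}) :
  is_diagonal e -> is_diagonal f -> crossing e f = crossing f e.
Proof.
move=> /diagonal_set2[a [b ->]] /diagonal_set2[c [d ->]].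
by rewrite !crossing_set2 separate_sym.
Qed.

Lemma separate_ordS_side n (x c d : 'I_n) : separate x (ordS x) c d = false.
Proof.
have := ltn_ord x; have := ltn_ord c; have := ltn_ord d.
rewrite /separate /between; move: (val_ordS x) => /= ->.
by case: ifP; lia.
Qed.

Lemma crossing_irr n (e : {set 'I_n}) : is_diagonal e -> crossing e e = false.
Proof.
move=> /diagonal_set2[a [b ->]]; rewrite crossing_set2 /separate; lia.
Qed.

(** The usable form of maximality: it only asks for adding one diagonal. *)
Lemma TRI_P n (D : {set {set 'I_n}}) : reflect
  [/\ forall e, e \in D -> is_diagonal e,
      forall e f, e \in D -> f \in D -> ~~ crossing e f
    & forall e, is_diagonal e -> (forall f, f \in D -> ~~ crossing e f) ->
        e \in D]
  (D \in TRI n).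
Proof.
rewrite inE; apply: (iffP maxsetP).
- move=> [/andP[/forall_inP dD /forall_inP cD] maxD].
  have cD' e f : e \in D -> f \in D -> ~~ crossing e f.
    by move=> De Df; have /forall_inP := cD e De; apply.
  split => // e de ce.
  suff <- : e |: D = D by rewrite setU11.
  apply: maxD; last exact: subsetUr.
  apply/andP; split; first by apply/forall_inP => f; rewrite !inE => /predU1P[->|/dD].
  apply/forall_inP => f; rewrite in_setU1 => /predU1P Df.
  apply/forall_inP => g; rewrite in_setU1 => /predU1P Dg.
  case: Df => [->|Df]; case: Dg => [->|Dg]; first by rewrite crossing_irr.
  - exact: ce.
  - by rewrite (crossing_sym (dD _ Df) de); apply: ce.
  - exact: cD'.
- move=> [dD cD maxD]; split.
    apply/andP; split; first exact/forall_inP.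
    by apply/forall_inP => e De; apply/forall_inP => f; apply: cD.
  move=> B /andP[/forall_inP dB /forall_inP cB] sDB.
  apply/eqP; rewrite eqEsubset sDB andbT; apply/subsetP => e Be.
  apply: maxD; first exact: dB.
  by move=> f /(subsetP sDB) Bf; have /forall_inP := cB e Be; apply.
Qed.

(** Ears are counted by their first vertex, which is what a rotation moves and
    what the grafting below relabels. *)
Definition ear_starts n (D : {set {set 'I_n}}) : {set 'I_n} :=
  [set i | adjacent D i (ordS (ordS i))].

Lemma ordS_neq n (i : 'I_n) : 1 < n -> ordS i != i.
Proof.
move=> hn; have := ltn_ord i; rewrite -val_eqE; move: (val_ordS i) => /= ->.
case: ifP; lia.
Qed.

Lemma ordS2_neq n (i : 'I_n) : 2 < n -> ordS (ordS i) != i.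
Proof.
move=> hn; have := ltn_ord i; rewrite -val_eqE.
move: (val_ordS (ordS i)) (val_ordS i) => /= -> ->.
case: (eqVneq (val i).+1 n) => /= h; case: ifP; lia.
Qed.

Lemma ordS3_neq n (i : 'I_n) : 3 < n -> ordS (ordS (ordS i)) != i.
Proof.
move=> hn; have := ltn_ord i; rewrite -val_eqE.
move: (val_ordS (ordS (ordS i))) (val_ordS (ordS i)) (val_ordS i) => /= -> -> ->.
case: (eqVneq (val i).+1 n) => /= h; do 2?case: ifP; lia.
Qed.

(** For n = 3 the three ear starts all give the same triangle. *)
Lemma card_ears n (D : {set {set 'I_n}}) : 3 < n -> #|ears D| = #|ear_starts D|.
Proof.
move=> hn; pose tri (i : 'I_n) := [set i; ordS i; ordS (ordS i)].
have -> : ears D = tri @: ear_starts D.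
  apply/setP => t; rewrite inE; apply/existsP/imsetP.
    by case=> i /and4P[/eqP-> _ _ ?]; exists i; rewrite ?inE.
  case=> i; rewrite inE => ai ->; exists i.
  by rewrite eqxx ai /adjacent !is_side_set2 !eqxx.
rewrite card_imset // => i j E.
have: j \in tri i by rewrite E !inE eqxx.
have: ordS j \in tri i by rewrite E !inE eqxx !orbT.
have: ordS (ordS j) \in tri i by rewrite E !inE eqxx !orbT.
rewrite !inE -!orbA !(inj_eq (@ordS_inj n)).
have [S1 S2 S3] : [/\ ordS i != i, ordS (ordS i) != i & ordS (ordS (ordS i)) != i].
  by rewrite ordS_neq ?ordS2_neq ?ordS3_neq //; lia.
move=> h2 h1 /or3P[]/eqP Ej //; move: h1 h2; rewrite !Ej !(inj_eq (@ordS_inj n)).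
  by rewrite (negPf S1) (negPf S2) (negPf S3).
by rewrite (negPf S1) (negPf S2) (negPf S3).
Qed.

(** * Rotations *)

Lemma rot_actionE n (D : {set {set 'I_n}}) (g : {perm 'I_n}) :
  rot_action n D g = [set [set g x | x in e] | e : {set 'I_n} in D].
Proof. by []. Qed.

Lemma imset2_eq (T S : finType) (f : T -> S) (a b : T) :
  [set f x | x in [set a; b]] = [set f a; f b].
Proof. by rewrite imsetU1 imset_set1. Qed.

Lemma mem_rot_action n (D : {set {set 'I_n}}) (g : {perm 'I_n})
    (e : {set 'I_n}) :
  ([set g x | x in e] \in rot_action n D g) = (e \in D).
Proof. by rewrite rot_actionE mem_imset //; apply/imset_inj/perm_inj. Qed.

Lemma rot_verticesE n (x : 'I_n) : rot_vertices n x = ordS x.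
Proof. by rewrite permE. Qed.

Section RotationInvariance.

Variable n : nat.
Let rot : {perm 'I_n} := rot_vertices n.

Lemma is_diagonal_rot (e : {set 'I_n}) :
  is_diagonal [set rot x | x in e] = is_diagonal e.
Proof.
have [/cards2P[a [b [_ ->]]]|ne] := boolP (#|e| == 2); last first.
  by rewrite /is_diagonal card_imset ?(negPf ne) //; apply: perm_inj.
rewrite imset2_eq !is_diagonal_set2 !rot_verticesE.
by rewrite !(inj_eq (@ordS_inj n)).
Qed.

Lemma TRI_rot (D : {set {set 'I_n}}) :
  D \in TRI n -> rot_action n D rot \in TRI n.
Proof.
case/TRI_P => dD cD maxD.
have crE e f : e \in D -> is_diagonal f ->
    crossing [set rot x | x in f] [set rot x | x in e] = crossing f e.
  move=> /dD/diagonal_set2[a [b ->]] /diagonal_set2[c [d ->]].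
  by rewrite !imset2_eq !crossing_set2 !rot_verticesE separate_ordS.
apply/TRI_P; split.
- by move=> _ /imsetP[e De ->]; rewrite is_diagonal_rot dD.
- move=> _ _ /imsetP[e De ->] /imsetP[f Df ->].
  by rewrite crE ?cD ?dD.
- move=> e de ce.
  have eE : e = [set rot x | x in [set (rot^-1)%g x | x in e]].
    by rewrite -imset_comp (eq_imset (g := id)) ?imset_id // => x /=; rewrite permKV.
  move: de ce; rewrite eE is_diagonal_rot mem_rot_action => de ce.
  apply: maxD => // f Df; rewrite -(crE f) //.
  by apply: ce; rewrite mem_rot_action.
Qed.

Lemma adjacent_rot (D : {set {set 'I_n}}) i j :
  adjacent (rot_action n D rot) (rot i) (rot j) = adjacent D i j.
Proof.
rewrite /adjacent -imset2_eq mem_rot_action imset2_eq !is_side_set2.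
by rewrite !rot_verticesE !(inj_eq (@ordS_inj n)).
Qed.

Lemma mem_ear_starts_rot (D : {set {set 'I_n}}) i :
  (rot i \in ear_starts (rot_action n D rot)) = (i \in ear_starts D).
Proof. by rewrite !inE -[RHS]adjacent_rot !rot_verticesE. Qed.

Lemma mem_ear_starts_rotX (D : {set {set 'I_n}}) i j :
  ((rot ^+ j)%g i \in ear_starts (rot_action n D (rot ^+ j)%g)) =
  (i \in ear_starts D).
Proof.
elim: j i D => [|j IHj] i D; first by rewrite expg0 perm1 act1.
by rewrite expgS permM actM IHj mem_ear_starts_rot.
Qed.

Lemma card_ear_starts_rot (D : {set {set 'I_n}}) :
  #|ear_starts (rot_action n D rot)| = #|ear_starts D|.
Proof.
rewrite -[RHS](card_imset _ (@perm_inj _ rot)); apply: eq_card => x.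
rewrite -[x](permKV rot) mem_ear_starts_rot mem_imset //; exact: perm_inj.
Qed.

Lemma TRI_ear_acts k : 3 < n -> [acts <[rot]>%g, on TRI_ear n k | rot_action n].
Proof.
move=> hn; rewrite cycle_subG; apply/astabsP => D.
have sub E : E \in TRI_ear n k -> rot_action n E rot \in TRI_ear n k.
  rewrite !(in_set (fun _ => _ && _)) !card_ears // card_ear_starts_rot.
  by case/andP => /TRI_rot-> ->.
apply/idP/idP => [h|]; last exact: sub.
have /= subX j E : E \in TRI_ear n k -> rot_action n E (rot ^+ j)%g \in TRI_ear n k.
  by elim: j E => [|j IHj] E hE; rewrite ?expg0 ?act1 // expgS actM IHj // sub.
rewrite -(actK (rot_action n) rot D) invg_expg; exact: subX.
Qed.

End RotationInvariance.

Lemma val_rotX n (j : nat) (x : 'I_n) :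
  val ((rot_vertices n ^+ j)%g x) = (x + j) %% n.
Proof.
elim: j x => [|j IHj] x; first by rewrite expg0 perm1 addn0 modn_small.
rewrite expgSr permM rot_verticesE /=.
by rewrite -addn1 -[in LHS](modnDml (val _)) modnDml IHj modnDml addn1 addnS.
Qed.

Lemma order_rot n : 0 < n -> #[rot_vertices n]%g = n.
Proof.
move=> n_gt0; apply/eqP; rewrite eqn_dvd; apply/andP; split.
  rewrite order_dvdn; apply/eqP/permP => x; apply: val_inj.
  by rewrite val_rotX perm1 modnDr modn_small.
have := expg_order (rot_vertices n).
move/permP/(_ (Ordinal n_gt0))/(congr1 val); rewrite val_rotX perm1 /=.
by rewrite add0n => /eqP.
Qed.

Lemma TRI_uncrossed n (D : {set {set 'I_n}}) (a b c d : 'I_n) : D \in TRI n ->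
  [set a; b] \in D -> [set c; d] \in D -> separate a b c d = false.
Proof.
by move=> /TRI_P[_ cD _] Dab Dcd; rewrite -crossing_set2; apply: negbTE; exact: cD.
Qed.

Lemma separate_ear n (i w : 'I_n) : w \notin [set i; ordS i; ordS (ordS i)] ->
  separate i (ordS (ordS i)) (ordS i) w.
Proof.
rewrite !inE -!val_eqE /= /separate /between.
have := ltn_ord i; have := ltn_ord w.
move: (val_ordS (ordS i)) (val_ordS i) => /= -> ->.
by case: (eqVneq (val i).+1 n) => /= h; case: ifP; lia.
Qed.

Lemma ear_startsE n (D : {set {set 'I_n}}) (i : 'I_n) : 3 < n ->
  (i \in ear_starts D) = ([set i; ordS (ordS i)] \in D).
Proof.
move=> hn; rewrite inE /adjacent is_side_set2 (inj_eq (@ordS_inj n)).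
rewrite (negPf (ordS_neq _ _)) ?[i == _]eq_sym ?(negPf (ordS3_neq _ _)) //; lia.
Qed.

Lemma ear_starts_not_consecutive n (D : {set {set 'I_n}}) (i : 'I_n) :
  3 < n -> D \in TRI n -> i \in ear_starts D -> ordS i \notin ear_starts D.
Proof.
move=> hn triD; rewrite !ear_startsE // => Di; apply/negP => DSi.
have := TRI_uncrossed triD Di DSi; rewrite separate_ear //.
by rewrite !inE !negb_or ordS3_neq // ordS2_neq ?ordS_neq; lia.
Qed.

(** A shortest diagonal closes an ear.  If the diagonal {a, b} has length more
    than 2, then {a, a+2} is either present, or crossed by a diagonal from a+1,
    whose other end is in (a+2, b] as it does not cross {a, b}; both are
    shorter. *)
Lemma ear_starts_neq0 n (D : {set {set 'I_n}}) :
  3 < n -> D \in TRI n -> ear_starts D != set0.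
Proof.
move=> hn triD; have /TRI_P[dD cD maxD] := triD.
suff [a [b [Dab lab bE]]] : exists a b : 'I_n,
    [/\ [set a; b] \in D, a < b & b = a.+2 :> nat].
  apply/set0Pn; exists a; rewrite ear_startsE //.
  suff -> : ordS (ordS a) = b by [].
  apply: val_inj; have := ltn_ord b.
  move: (val_ordS (ordS a)) (val_ordS a) => /= -> ->.
  case: (eqVneq (val a).+1 n) => /= h; case: ifP; lia.
have shrink L (a b : 'I_n) : [set a; b] \in D -> a < b -> b - a <= L ->
   exists a b : 'I_n, [/\ [set a; b] \in D, a < b & b = a.+2 :> nat].
  elim: L a b => [|L IH] a b Dab lab hL; first lia.
  have [E|ne] := eqVneq (val b) (val a).+2; first by exists a, b.
  have lb := ltn_ord b.
  have := dD _ Dab; rewrite is_diagonal_set2 -!val_eqE.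
  move: (val_ordS a) (val_ordS b) ne => /= -> -> ne /and3P[_ /= h1 h2].
  have {}h1 : (b : nat) != a.+1 by move: h1; case: ifP; lia.
  have ltc : a.+2 < n by move: h1 => /=; lia.
  pose c := Ordinal ltc.
  have dac : is_diagonal [set a; c].
    rewrite is_diagonal_set2 -!val_eqE.
    move: (val_ordS a) (val_ordS c) => /= -> ->; case: ifP; case: ifP; lia.
  have [Dac|nDac] := boolP ([set a; c] \in D); first by exists a, c.
  have /forall_inPn[f Df] : ~~ [forall f in D, ~~ crossing [set a; c] f].
    by apply/negP => /forall_inP h; case/negP: nDac; apply: maxD.
  have /diagonal_set2[x [y fE]] := dD _ Df; rewrite {}fE in Df *.
  rewrite negbK crossing_set2 => sep.
  have := TRI_uncrossed triD Dab Df => nsep.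
  (* a + 1 is the only vertex strictly between a and c = a + 2. *)
  wlog xE : x y Df sep nsep / val x = (val a).+1.
    move=> wl; have [xE|nx] := eqVneq (val x) (val a).+1; first exact: (wl x y).
    apply: (wl y x); rewrite 1?setUC //; move: sep nsep nx ne h1;
      rewrite /separate /between /=; lia.
  apply: (IH x y Df); move: sep nsep ne h1 xE; rewrite /separate /between /=; lia.
have [D0|/set0Pn[e De]] := eqVneq D set0.
  have l2 : 2 < n by lia.
  have l0 : 0 < n by lia.
  suff : [set Ordinal l0; Ordinal l2] \in D by rewrite D0 inE.
  apply: maxD => [|f]; last by rewrite D0 inE.
  rewrite is_diagonal_set2 -!val_eqE.
  move: (val_ordS (Ordinal l0)) (val_ordS (Ordinal l2)) => /= -> ->; do 2?case: ifP; lia.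
have /diagonal_set2[x [y eE]] := dD _ De; rewrite {}eE in De *.
have := dD _ De; rewrite is_diagonal_set2 -!val_eqE => /andP[/= nxy _].
have [lxy|lyx] := ltnP x y; first exact: (shrink _ x y De lxy (leqnn _)).
by apply: (shrink _ y x _ _ (leqnn _)); [rewrite setUC|lia].
Qed.

(** * Gluing triangles onto sides, and cutting ears off *)

(** The p-gon sits in the n-gon through phi, which leaves one new vertex, the
    successor of phi x, beyond each side {x, x+1} with x in R. *)
Record inserts_ears p n (phi : 'I_p -> 'I_n) (R : {set 'I_p}) : Prop := {
  inserts_from : 2 < p;
  inserts_into : 3 < n;
  inserts_ltn : forall x y, (phi x < phi y) = (x < y);
  inserts_ordS : forall x,
    phi (ordS x) = if x \in R then ordS (ordS (phi x)) else ordS (phi x);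
  inserts_gap : forall x y, x \in R -> ordS (phi x) != phi y;
  inserts_cover : forall v,
    (exists x, v = phi x) \/ (exists2 x, x \in R & v = ordS (phi x)) }.

Section Graft.

Variables (p n : nat) (phi : 'I_p -> 'I_n) (R : {set 'I_p}).
Hypothesis phiP : inserts_ears phi R.

Let p_gt2 := inserts_from phiP.
Let n_gt3 := inserts_into phiP.
Let ltn_phi := inserts_ltn phiP.
Let phi_ordS := inserts_ordS phiP.
Let phi_gap := inserts_gap phiP.
Let phi_cover := inserts_cover phiP.

Definition lift_chord (e : {set 'I_p}) : {set 'I_n} := [set phi x | x in e].

Definition root_sides : {set {set 'I_p}} := [set [set x; ordS x] | x in R].

(** A side in R becomes the chord below its new vertex, so it is lifted along
    with the diagonals. *)
Definition graft (D : {set {set 'I_p}}) : {set {set 'I_n}} :=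
  [set lift_chord e | e in D :|: root_sides].

Definition prune (D : {set {set 'I_n}}) : {set {set 'I_p}} :=
  [set e | is_diagonal e && (lift_chord e \in D)].

Lemma phi_inj : injective phi.
Proof.
move=> x y E; apply: val_inj => /=.
have := ltn_phi x y; have := ltn_phi y x; rewrite E ltnn; lia.
Qed.

Lemma lift_chord_inj : injective lift_chord.
Proof. exact/imset_inj/phi_inj. Qed.

Lemma separate_phi a b c d :
  separate (phi a) (phi b) (phi c) (phi d) = separate a b c d.
Proof.
rewrite /separate /between !ltn_phi.
by rewrite !(inj_eq val_inj) !(inj_eq phi_inj).
Qed.

Lemma phi_side x y : (phi y == ordS (phi x)) = (x \notin R) && (y == ordS x).
Proof.
have [Rx|nRx] := boolP (x \in R); first by rewrite eq_sym (negPf (phi_gap _ Rx)).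
by rewrite -(inj_eq phi_inj) phi_ordS (negPf nRx).
Qed.

Lemma lift_chord_root x : x \in R ->
  lift_chord [set x; ordS x] = [set phi x; ordS (ordS (phi x))].
Proof. by move=> Rx; rewrite /lift_chord imset2_eq phi_ordS Rx. Qed.

Lemma is_diagonal_lift (e : {set 'I_p}) :
  is_diagonal e -> is_diagonal (lift_chord e).
Proof.
move=> de; have [x [y E]] := diagonal_set2 de; move: de.
rewrite {}E /lift_chord imset2_eq !is_diagonal_set2 !phi_side (inj_eq phi_inj).
by case/and3P=> -> /negPf-> /negPf->; rewrite !andbF.
Qed.

Lemma is_diagonal_ear (i : 'I_n) :
  is_diagonal [set i; ordS (ordS i)].
Proof.
rewrite is_diagonal_set2 (inj_eq (@ordS_inj n)) eq_sym ordS2_neq; last lia.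
by rewrite ordS_neq 1?eq_sym ?ordS3_neq //; lia.
Qed.

Lemma mem_root_side x : x \in R -> [set x; ordS x] \in root_sides.
Proof. by move=> Rx; apply/imsetP; exists x. Qed.

Lemma mem_lift_graft (D : {set {set 'I_p}}) (e : {set 'I_p}) :
  (lift_chord e \in graft D) = (e \in D) || (e \in root_sides).
Proof. by rewrite mem_imset ?inE //; apply: lift_chord_inj. Qed.

(** This is why pruning a graft does not keep the lifted sides. *)
Lemma root_side_not_diagonal (e : {set 'I_p}) :
  e \in root_sides -> is_diagonal e = false.
Proof.
by case/imsetP => x _ ->; rewrite is_diagonal_set2 eqxx andbF.
Qed.

Lemma graftK (D : {set {set 'I_p}}) :
  (forall e, e \in D -> is_diagonal e) -> prune (graft D) = D.
Proof.
move=> dD; apply/setP => e; rewrite inE mem_lift_graft.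
have [De|nDe] := boolP (e \in D); first by rewrite dD.
by apply/negP => /andP[de /root_side_not_diagonal]; rewrite de.
Qed.

(** Maximality is inherited: a diagonal ending at a new vertex crosses the
    lifted side below it, and any other one is the lift of a diagonal or of a
    side in R. *)
Lemma graft_TRI D : D \in TRI p -> graft D \in TRI n.
Proof.
case/TRI_P => dD cD maxD; apply/TRI_P; split.
- move=> _ /imsetP[e + ->]; rewrite inE => /orP[/dD/is_diagonal_lift //|].
  by case/imsetP => x Rx ->; rewrite lift_chord_root // is_diagonal_ear.
- have pair e : e \in D :|: root_sides -> exists a b,
      e = [set a; b] /\ (e \in D \/ b = ordS a).
    rewrite inE => /orP[De|]; last by case/imsetP => x _ ->; exists x, (ordS x); auto.
    by have [a [b E]] := diagonal_set2 (dD _ De); exists a, b; auto.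
  move=> _ _ /imsetP[e he ->] /imsetP[f hf ->].
  have [a [b [Ee oe]]] := pair e he; have [c [d [Ef of']]] := pair f hf.
  rewrite Ee Ef /lift_chord !imset2_eq crossing_set2 separate_phi.
  case: oe => [De|->]; last by rewrite separate_ordS_side.
  case: of' => [Df|->]; last by rewrite separate_sym separate_ordS_side.
  by rewrite -crossing_set2 -Ee -Ef cD.
- move=> e de ce; have [v [w E]] := diagonal_set2 de.
  have isol x u : x \in R -> e != [set ordS (phi x); u].
    move=> Rx; apply/negP => /eqP E'; move: de (ce (lift_chord [set x; ordS x])).
    rewrite E' lift_chord_root // is_diagonal_set2 (inj_eq (@ordS_inj n)).
    case/and3P => h1 h2 h3 /(_ _); rewrite crossing_set2 separate_sym separate_ear.
      by move=> /(_ _)/negP; case=> //; rewrite -lift_chord_root // mem_lift_graft mem_root_side ?orbT.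
    by rewrite !inE !negb_or eq_sym h3 eq_sym h1 h2.
  have [[x vE]|[x Rx vE]] := phi_cover v; last first.
    by have := isol x w Rx; rewrite E vE eqxx.
  have [[y wE]|[y Ry wE]] := phi_cover w; last first.
    by have := isol y v Ry; rewrite E wE setUC eqxx.
  have eE : e = lift_chord [set x; y] by rewrite E vE wE /lift_chord imset2_eq.
  rewrite eE mem_lift_graft; have [//|nD] := boolP (_ \in D); rewrite orFb.
  have [dxy|] := boolP (is_diagonal [set x; y]).
    case/negP: nD; apply: maxD => // f Df.
    have := ce (lift_chord f); rewrite mem_lift_graft Df => /(_ isT).
    rewrite eE; have [a [b ->]] := diagonal_set2 (dD _ Df).
    by rewrite /lift_chord !imset2_eq !crossing_set2 separate_phi.
  move: de; rewrite eE /lift_chord imset2_eq !is_diagonal_set2 !phi_side.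
  rewrite (inj_eq phi_inj) => /and3P[-> h1 h2]; rewrite /= negb_and !negbK.
  case/orP => /eqP Exy; move: h1 h2; rewrite Exy eqxx !andbT !negbK => h1 h2.
    exact: mem_root_side.
  by rewrite setUC; apply: mem_root_side.
Qed.

Lemma graft_roots D : phi @: R \subset ear_starts (graft D).
Proof.
apply/subsetP => _ /imsetP[x Rx ->]; rewrite ear_startsE //.
by rewrite -lift_chord_root // mem_lift_graft mem_root_side ?orbT.
Qed.

Lemma no_chord_at_new_vertex (D : {set {set 'I_n}}) x u v :
  D \in TRI n -> phi @: R \subset ear_starts D ->
  x \in R -> v = ordS (phi x) -> [set v; u] \notin D.
Proof.
move=> triD /subsetP rootD Rx ->; apply/negP => Du.
have := rootD (phi x); rewrite imset_f // ear_startsE // => /(_ isT) Dx.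
have := TRI_uncrossed triD Dx Du; rewrite separate_ear //.
have /TRI_P[dD _ _] := triD; have := dD _ Du.
rewrite is_diagonal_set2 (inj_eq (@ordS_inj n)) !inE !negb_or.
by case/and3P => h1 h2 h3; rewrite eq_sym h3 eq_sym h1.
Qed.

Lemma TRI_rooted_lift (D : {set {set 'I_n}}) (e : {set 'I_n}) :
  D \in TRI n -> phi @: R \subset ear_starts D ->
  e \in D -> exists x y, e = lift_chord [set x; y].
Proof.
move=> triD rootD De; have /TRI_P[dD _ _] := triD.
have [v [w E]] := diagonal_set2 (dD _ De); rewrite {}E in De *.
have [[x vE]|[x Rx vE]] := phi_cover v; last first.
  by have := no_chord_at_new_vertex w triD rootD Rx vE; rewrite De.
have [[y wE]|[y Ry wE]] := phi_cover w; last first.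
  by have := no_chord_at_new_vertex v triD rootD Ry wE; rewrite setUC De.
by exists x, y; rewrite vE wE /lift_chord imset2_eq.
Qed.

(** Sides of the p-gon cross nothing, so that a diagonal compatible with the
    pruned triangulation lifts to one compatible with D. *)
Lemma prune_TRI D : D \in TRI n -> phi @: R \subset ear_starts D ->
  prune D \in TRI p.
Proof.
move=> triD rootD; have /TRI_P[dD cD maxD] := triD; apply/TRI_P; split.
- by move=> e; rewrite inE => /andP[].
- move=> e f; rewrite !inE => /andP[/diagonal_set2[a [b ->]] De].
  case/andP=> /diagonal_set2[c [d ->]] Df; have := cD _ _ De Df.
  by rewrite /lift_chord !imset2_eq !crossing_set2 separate_phi.
- move=> e de ce; rewrite inE de; apply: maxD; first exact: is_diagonal_lift.
  move=> f Df; have [x [y fE]] := TRI_rooted_lift triD rootD Df.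
  have [a [b eE]] := diagonal_set2 de; have df := dD _ Df.
  rewrite fE eE /lift_chord !imset2_eq crossing_set2 separate_phi -crossing_set2.
  have [dxy|] := boolP (is_diagonal [set x; y]).
    by rewrite -eE; apply: ce; rewrite inE dxy -fE.
  rewrite is_diagonal_set2 crossing_set2 separate_sym.
  have -> : x != y.
    by apply: contraTneq df => xy; rewrite fE xy /lift_chord imset2_eq is_diagonal_set2 eqxx.
  rewrite /= negb_and !negbK => /orP[]/eqP->; first by rewrite separate_ordS_side.
  suff -> : separate (ordS y) y a b = separate y (ordS y) a b.
    by rewrite separate_ordS_side.
  by rewrite /separate /between; lia.
Qed.

Lemma pruneK D : D \in TRI n -> phi @: R \subset ear_starts D ->
  graft (prune D) = D.
Proof.
move=> triD rootD; have /TRI_P[dD _ maxD] := triD.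
have /TRI_P[_ cG _] := graft_TRI (prune_TRI triD rootD).
have sub e : e \in graft (prune D) -> e \in D.
  case/imsetP => f + ->; rewrite !inE => /orP[/andP[_ //]|/imsetP[x Rx ->]].
  rewrite lift_chord_root // -ear_startsE //.
  by apply: (subsetP rootD); apply: imset_f.
apply/eqP; rewrite eqEsubset; apply/andP; split; apply/subsetP => // e De.
have [x [y eE]] := TRI_rooted_lift triD rootD De; have := dD _ De.
rewrite eE mem_lift_graft inE -eE De andbT.
rewrite eE /lift_chord imset2_eq !is_diagonal_set2 !phi_side (inj_eq phi_inj).
case/and3P => -> h1 h2 /=; have [/eqP yE|_] := boolP (y == ordS x).
  by move: h1; rewrite yE eqxx andbT negbK => Rx; rewrite mem_root_side ?orbT.
have [/eqP xE|//] := boolP (x == ordS y).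
by move: h2; rewrite xE eqxx andbT negbK => Ry; rewrite setUC mem_root_side ?orbT.
Qed.

Lemma adjacent_graft D x y :
  adjacent (graft D) (phi x) (phi y) = adjacent D x y.
Proof.
rewrite /adjacent -imset2_eq mem_lift_graft imset2_eq !is_side_set2 !phi_side.
have -> : ([set x; y] \in root_sides) =
    (x \in R) && (y == ordS x) || (y \in R) && (x == ordS y).
  apply/imsetP/orP => [[z Rz /eqP]|].
    by rewrite set2_eqE => /orP[]/andP[/eqP-> /eqP->]; rewrite Rz eqxx; auto.
  by case=> /andP[Rz /eqP->]; [exists x | exists y; rewrite // setUC].
by case: (x \in R); case: (y \in R); case: (y == _); case: (x == _);
  rewrite ?orbT ?orbF.
Qed.

(** The new ears start at the lifts of R.  An old ear survives unless a triangle
    was glued onto one of the two sides that it has in common with the p-gon,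
    which begin at x and x+1. *)
Lemma ear_starts_graft D : ear_starts (graft D) =
  phi @: (R :|: [set x in ear_starts D | (x \notin R) && (ordS x \notin R)]).
Proof.
have no_edge v w : (exists2 x, x \in R & v = ordS (phi x)) ->
    [set v; w] \notin graft D.
  case=> x Rx ->; apply/imsetP => -[e _ E].
  have: ordS (phi x) \in lift_chord e by rewrite -E set21.
  by case/imsetP => y _ /eqP; rewrite (negPf (phi_gap _ Rx)).
apply/setP => v; have [[x ->]|[x Rx ->]] := phi_cover v; last first.
  rewrite ear_startsE // (negPf (no_edge _ _ _)); last by exists x.
  apply/esym/negbTE/imsetP => -[y _ /eqP].
  by rewrite (negPf (phi_gap _ Rx)).
rewrite mem_imset; last exact: phi_inj.
rewrite in_setU; have [Rx|nRx] := boolP (x \in R).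
  by apply: (subsetP (graft_roots D)); apply: imset_f.
have E : ordS (phi x) = phi (ordS x) by rewrite phi_ordS (negPf nRx).
rewrite orFb [in RHS]inE nRx; have [RSx|nRSx] := boolP (ordS x \in R) => /=.
  rewrite andbF ear_startsE // E setUC; apply: negbTE; apply: no_edge.
  by exists (ordS x).
have E2 : ordS (phi (ordS x)) = phi (ordS (ordS x)).
  by rewrite [RHS]phi_ordS (negPf nRSx).
by rewrite andbT !inE E E2 adjacent_graft.
Qed.

Lemma card_ear_starts_graft D : #|ear_starts (graft D)| =
  #|R| + #|[set x in ear_starts D | (x \notin R) && (ordS x \notin R)]|.
Proof.
rewrite ear_starts_graft card_imset; last exact: phi_inj.
rewrite cardsU; set A := [set x in _ | _].
suff -> : R :&: A = set0 by rewrite cards0 subn0.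
by apply/setP => x; rewrite !inE; case: (x \in R); rewrite ?andbF.
Qed.

Lemma graft_rot (j k : nat) D :
  (forall x, phi ((rot_vertices p ^+ j)%g x) = (rot_vertices n ^+ k)%g (phi x)) ->
  (forall x, ((rot_vertices p ^+ j)%g x \in R) = (x \in R)) ->
  graft (rot_action p D (rot_vertices p ^+ j)%g) =
  rot_action n (graft D) (rot_vertices n ^+ k)%g.
Proof.
move=> phi_rot R_rot; set g := (rot_vertices p ^+ j)%g.
have rootX : rot_action p root_sides g = root_sides.
  have sub (e : {set 'I_p}) : e \in root_sides -> [set g x | x in e] \in root_sides.
    case/imsetP => x Rx ->; rewrite imset2_eq.
    suff -> : g (ordS x) = ordS (g x) by rewrite mem_root_side // R_rot.
    by rewrite /g -!rot_verticesE -!permM -expgSr -expgS.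
  apply/eqP; rewrite eqEcard card_setact leqnn andbT.
  by apply/subsetP => _ /imsetP[e he ->]; apply: sub.
rewrite /graft -{1}rootX !rot_actionE -imsetU -!imset_comp.
apply: eq_imset => e /=; rewrite /lift_chord -!imset_comp.
by apply: eq_imset => x /=; rewrite phi_rot.
Qed.

End Graft.

(** * Counting symmetric triangulations by their ears *)

(** Here j is the number of steps of the rotation; for n = e M it is taken to be
    M, so that the rotation has order e. *)
Definition sym_tri (n j k : nat) : {set {set {set 'I_n}}} :=
  [set D in TRI n | (rot_action n D (rot_vertices n ^+ j)%g == D)
                    && (#|ear_starts D| == k)].

Lemma rotX_trans n (i i' : 'I_n) : exists j, i' = (rot_vertices n ^+ j)%g i.
Proof.
exists (n - i + i'); apply: val_inj; rewrite val_rotX.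
have -> : i + (n - i + i') = n + i' by have := ltn_ord i; lia.
by rewrite modnDl modn_small.
Qed.

(** Both sides count the pairs of a triangulation and an ear start: rotation
    makes all n vertices equally frequent. *)
Lemma sym_tri_double_count n j k (i0 : 'I_n) :
  k * #|sym_tri n j k| = n * #|[set D in sym_tri n j k | i0 \in ear_starts D]|.
Proof.
pose f (i : 'I_n) := #|[set D in sym_tri n j k | i \in ear_starts D]|.
have f_rot i : f i <= f (rot_vertices n i).
  rewrite /f -(card_imset _ (act_inj (rot_action n) (rot_vertices n))).
  apply/subset_leq_card/subsetP => _ /imsetP[D + ->].
  rewrite !(in_set (fun _ => _ && _)) mem_ear_starts_rot card_ear_starts_rot.
  rewrite -actM -expgS expgSr actM.
  by case/andP=> /and3P[/TRI_rot-> /eqP-> ->] ->; rewrite eqxx.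
have f_le i i' : f i <= f i'.
  have [m ->] := rotX_trans i i'; elim: m => [|m IHm]; first by rewrite expg0 perm1.
  by rewrite expgSr permM; apply: leq_trans IHm (f_rot _).
have f_const i : f i = f i0 by apply/eqP; rewrite eqn_leq !f_le.
rewrite -/(f i0) -[n in RHS]card_ord -sum_nat_const -(eq_bigr _ (fun i _ => f_const i)).
rewrite mulnC -sum_nat_const.
transitivity (\sum_(D in sym_tri n j k) \sum_i (i \in ear_starts D)).
  apply: eq_bigr => D; rewrite inE => /and3P[_ _ /eqP <-].
  by rewrite -sum1_card big_mkcond; apply: eq_bigr => i _; case: ifP.
rewrite exchange_big; apply: eq_bigr => i _; rewrite /f -sum1_card.
rewrite -big_mkcondr; apply: eq_bigl => D; by rewrite [in RHS]inE.
Qed.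

Lemma modn_block e M a r : r < M -> (a * M + r) %% (e * M) = a %% e * M + r.
Proof.
move=> lt_rM; case: e => [|e]; first by rewrite mul0n !modn0.
rewrite {1}(divn_eq a e.+1) mulnDl -mulnA -addnA modnMDl modn_small //.
have: (a %% e.+1).+1 * M <= e.+1 * M by rewrite leq_mul2r ltn_mod orbT.
by rewrite mulSn; lia.
Qed.

Lemma ltn_block e M a r : a < e -> r < M -> a * M + r < e * M.
Proof.
move=> lt_ae lt_rM; have: a.+1 * M <= e * M by rewrite leq_mul2r lt_ae orbT.
by rewrite mulSn; lia.
Qed.

Lemma block_eq M a r x : r < M -> x = a * M + r -> (x %/ M = a) * (x %% M = r).
Proof.
move=> lt_rM ->; have M_gt0 : 0 < M by lia.
by rewrite divnMDl // divn_small // addn0 modnMDl modn_small.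
Qed.

(** A set of vertices of the e M-gon that is invariant under rotation by M is a
    union of residue classes modulo M, each of size e. *)
Section Periodic.

Variables (e M : nat).
Let p := e * M.
Hypothesis M_gt0 : 0 < M.

Lemma card_residue r : r < M -> #|[set x : 'I_p | x %% M == r]| = e.
Proof.
move=> lt_rM; pose f (a : 'I_e) : 'I_p := Ordinal (ltn_block (ltn_ord a) lt_rM).
have f_inj : injective f.
  move=> a b /(congr1 val) /= E; apply: val_inj => /=; move: E.
  by move/addIn/eqP; rewrite eqn_mul2r => /orP[|/eqP//]; lia.
rewrite -[RHS]card_ord -(card_imset _ f_inj); apply: eq_card => x.
rewrite inE; apply/eqP/imsetP => [E|[a _ ->] /=]; last by rewrite modnMDl modn_small.
have lt_a : x %/ M < e by rewrite ltn_divLR.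
by exists (Ordinal lt_a) => //; apply: val_inj; rewrite /= -E -divn_eq.
Qed.

Variable A : {set 'I_p}.
Hypothesis A_per : forall x, ((rot_vertices p ^+ M)%g x \in A) = (x \in A).

Lemma periodic_mod (x y : 'I_p) : x = y %[mod M] -> (x \in A) = (y \in A).
Proof.
have A_perX j z : ((rot_vertices p ^+ (M * j))%g z \in A) = (z \in A).
  elim: j z => [|j IHj] z; first by rewrite muln0 expg0 perm1.
  by rewrite mulnS expgD permM IHj A_per.
wlog le_xy : x y / x <= y.
  by move=> wl E; case/orP: (leq_total x y) => ?; [|apply/esym]; exact: wl.
move=> E; suff -> : y = (rot_vertices p ^+ (M * ((y - x) %/ M)))%g x by rewrite A_perX.
apply: val_inj; rewrite val_rotX mulnC divnK; last by rewrite -eqn_mod_dvd // E.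
by rewrite subnKC // modn_small.
Qed.

Lemma card_periodic_residue (y : 'I_p) :
  #|[set x in A | x %% M == y %% M]| = e * (y \in A).
Proof.
have [Ay|nAy] := boolP (y \in A); last first.
  rewrite muln0; apply/eqP; rewrite cards_eq0; apply/eqP/setP => x.
  by rewrite !inE; apply/negP => /andP[Ax /eqP/periodic_mod E]; rewrite -E Ax in nAy.
rewrite muln1 -[RHS](@card_residue (y %% M)) ?ltn_mod //.
apply: eq_card => x; rewrite !inE; have [/eqP E|//] := boolP (_ == _); last by rewrite andbF.
by rewrite (periodic_mod E) Ay.
Qed.

Lemma dvdn_card_periodic : e %| #|A|.
Proof.
have lt_mod (x : 'I_p) : x %% M < M by rewrite ltn_mod.
rewrite -sum1_card (partition_big (fun x => Ordinal (lt_mod x)) predT) //=.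
apply: dvdn_sum => r _.
have [/existsP[y /eqP yr]|no] := boolP [exists y : 'I_p, y %% M == r].
  suff -> : \sum_(i in A | Ordinal (lt_mod i) == r) 1 = e * (y \in A).
    exact: dvdn_mulr.
  rewrite -card_periodic_residue -sum1_card; apply: eq_bigl => x.
  by rewrite [in RHS]inE -val_eqE /= yr.
rewrite big_pred0 ?dvdn0 // => x; apply: contraNF no => /andP[_ /eqP <-].
by apply/existsP; exists x.
Qed.

End Periodic.

Section CyclicGraft.

Variables (e M : nat).
Hypotheses (M_gt0 : 0 < M).
Let p := e * M.
Let n := e * M.+1.

Lemma skip_subproof (x : 'I_p) : x %/ M * M.+1 + x %% M < n.
Proof.
apply: ltn_block; first by rewrite ltn_divLR.
by apply: (@ltn_trans M) => //; rewrite ltn_mod.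
Qed.

(** The vertex a M + r of the e M-gon becomes a (M+1) + r; the vertices congruent
    to M modulo M+1 are new. *)
Definition skip (x : 'I_p) : 'I_n := Ordinal (skip_subproof x).

Definition skip_roots : {set 'I_p} := [set x : 'I_p | x %% M == M.-1].

Lemma skip_block a r x : r < M -> val x = a * M + r ->
  val (skip x) = a * M.+1 + r.
Proof. by move=> lt_rM /(block_eq lt_rM)[/= -> ->]. Qed.

Lemma skip_rot x : skip ((rot_vertices p ^+ M)%g x) =
  (rot_vertices n ^+ M.+1)%g (skip x).
Proof.
have lt_r : x %% M < M by rewrite ltn_mod.
apply: val_inj; rewrite val_rotX.
rewrite (@skip_block ((x %/ M).+1 %% e) (x %% M)) //; last first.
  by rewrite val_rotX -modn_block // mulSn {1}(divn_eq x M); congr (_ %% _); lia.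
by rewrite -modn_block ?mulSn /=; [congr (_ %% _)|]; lia.
Qed.

Lemma skip_roots_rot x :
  ((rot_vertices p ^+ M)%g x \in skip_roots) = (x \in skip_roots).
Proof.
by rewrite !inE val_rotX modn_dvdm ?modnDr // dvdn_mull.
Qed.

Lemma ltn_skip x y : (skip x < skip y) = (x < y).
Proof.
have mono (u v : 'I_p) : u < v -> skip u < skip v.
  move=> lt_uv; have := leq_div2r M (ltnW lt_uv).
  have lt_r : u %% M < M by rewrite ltn_mod.
  rewrite leq_eqVlt => /orP[/eqP E|lt_d] /=.
    have := divn_eq u M; have := divn_eq v M; rewrite E; lia.
  apply: leq_trans (leq_addr _ _); apply: ltn_block => //; lia.
have [/mono //|le_yx] := ltnP x y; apply/negbTE; rewrite -leqNgt.
by move: le_yx; rewrite leq_eqVlt => /orP[/eqP/val_inj->//|/mono/ltnW].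
Qed.

Lemma skip_ordS x : skip (ordS x) =
  if x \in skip_roots then ordS (ordS (skip x)) else ordS (skip x).
Proof.
have lt_r : x %% M < M by rewrite ltn_mod.
apply: val_inj; rewrite inE; case: eqP => [E|/eqP nE] /=.
  rewrite -[X in X %% n]addn1 modnDml.
  have -> : x.+1 %% p = ((x %/ M).+1 %% e) * M + 0.
    by rewrite -modn_block // mulSn {1}(divn_eq x M) E; congr (_ %% _); lia.
  have [-> ->] := @block_eq M ((x %/ M).+1 %% e) 0 _ M_gt0 erefl.
  rewrite -modn_block // E mulSn; congr (_ %% _); lia.
have lt_r1 : (x %% M).+1 < M by lia.
have -> : x.+1 %% p = ((x %/ M) %% e) * M + (x %% M).+1.
  by rewrite -modn_block // {1}(divn_eq x M); congr (_ %% _); lia.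
have [-> ->] := @block_eq M ((x %/ M) %% e) _ _ lt_r1 erefl.
by rewrite -modn_block; [congr (_ %% _)|]; lia.
Qed.

Lemma ordS_skip_root x : x \in skip_roots -> val (ordS (skip x)) %% M.+1 = M.
Proof.
rewrite inE => /eqP E /=; rewrite modn_dvdm ?dvdn_mull // E -addnS prednK //.
by rewrite modnMDl modn_small.
Qed.

Lemma skip_gap x y : x \in skip_roots -> ordS (skip x) != skip y.
Proof.
move=> /ordS_skip_root E; apply/eqP => E'; move: E; rewrite E' /= modnMDl.
have : y %% M < M by rewrite ltn_mod.
move=> lt_r; rewrite modn_small; lia.
Qed.

Lemma skip_cover (v : 'I_n) : (exists x, v = skip x) \/
  (exists2 x, x \in skip_roots & v = ordS (skip x)).
Proof.
have lt_a : v %/ M.+1 < e by rewrite ltn_divLR.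
have [lt_r|] := ltnP (v %% M.+1) M.
  left; exists (Ordinal (ltn_block lt_a lt_r)); apply: val_inj.
  by rewrite (@skip_block (v %/ M.+1) (v %% M.+1)) // -divn_eq.
have : v %% M.+1 < M.+1 by rewrite ltn_mod.
move=> lt_r le_r; have E : v %% M.+1 = M by lia.
have lt_M : M.-1 < M by lia.
right; exists (Ordinal (ltn_block lt_a lt_M)).
  by rewrite inE /= modnMDl modn_small.
set x := Ordinal _; have sx := @skip_block (v %/ M.+1) M.-1 x lt_M erefl.
apply: val_inj => /=; move: sx => /= ->; rewrite -addnS prednK //.
by rewrite -{3}E -divn_eq modn_small.
Qed.

End CyclicGraft.

Lemma ear_starts_periodic n j (D : {set {set 'I_n}}) :
  rot_action n D (rot_vertices n ^+ j)%g == D ->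
  forall x, ((rot_vertices n ^+ j)%g x \in ear_starts D) = (x \in ear_starts D).
Proof. by move=> /eqP E x; rewrite -{1}E mem_ear_starts_rotX. Qed.

Lemma skip_inserts_ears e M (M_gt0 : 0 < M) : 2 < e * M ->
  inserts_ears (@skip e M M_gt0) (skip_roots e M).
Proof.
move=> p_gt2; split => //.
- by move: p_gt2; case: e => // e h; rewrite mulnS; lia.
- exact: ltn_skip.
- exact: skip_ordS.
- exact: skip_gap.
- exact: skip_cover.
Qed.

Section GraftCount.

Variables (e M : nat).
Hypotheses (M_gt0 : 0 < M) (p_gt2 : 2 < e * M).
Let p := e * M.
Let n := e * M.+1.
Let R : {set 'I_p} := skip_roots e M.
Let phi : 'I_p -> 'I_n := @skip e M M_gt0.

Let e_gt0 : 0 < e. Proof. by move: p_gt2; case: (e). Qed.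
Let n_gt3 : 3 < n. Proof. by rewrite /n mulnS; lia. Qed.

Definition surviving_ears (D : {set {set 'I_p}}) : {set 'I_p} :=
  [set x in ear_starts D | (x \notin R) && (ordS x \notin R)].

(** Fix one orbit of ears, by the double count; cutting it off is a bijection
    onto the symmetric triangulations of the e M-gon. *)
Lemma sym_tri_graft_count k : k * #|sym_tri n M.+1 k| =
  n * #|[set D in TRI p | (rot_action p D (rot_vertices p ^+ M)%g == D)
                          && (e + #|surviving_ears D| == k)]|.
Proof.
have lt_x0 : M.-1 < p by rewrite /p; nia.
pose x0 : 'I_p := Ordinal lt_x0.
have Rx0 : x0 \in R by rewrite inE /= modn_small; lia.
rewrite (sym_tri_double_count _ _ (phi x0)); congr (_ * _).
have phiP : inserts_ears phi R by exact: skip_inserts_ears.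
have graftTRI := graft_TRI phiP.
have graftRot D := graft_rot D (@skip_rot e M M_gt0) (@skip_roots_rot e M).
have cardR : #|R| = e by apply: card_residue; lia.
have cardG := card_ear_starts_graft phiP.
have graftK := graftK phiP.
rewrite -[RHS](card_in_imset (f := graft phi R)); last first.
  move=> D D'; rewrite !inE -!/(_ \in TRI _) => /andP[hD _] /andP[hD' _] E.
  rewrite -[D](graftK D) -1?[D'](graftK D') -?E //.
    by have /TRI_P[] : D' \in TRI p by rewrite inE.
  by have /TRI_P[] : D \in TRI p by rewrite inE.
apply: eq_card => D; apply/idP/imsetP.
- rewrite in_set => /andP[]; rewrite in_set => /and3P[triD symD /eqP cardD] earD.
  have rootD : phi @: R \subset ear_starts D.
    apply/subsetP => _ /imsetP[x Rx ->].
    rewrite (periodic_mod (ear_starts_periodic symD) (y := phi x0)) //.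
    move: Rx Rx0; rewrite !inE => /eqP Ex /eqP Ex0.
    by rewrite /= !modnMDl Ex Ex0.
  have KD := pruneK phiP triD rootD.
  have triP := prune_TRI phiP triD rootD.
  exists (prune phi D) => //; rewrite in_set triP -cardR -cardG KD cardD eqxx andbT.
  have /TRI_P[dP _ _] := triP.
  have /TRI_P[dP' _ _] : rot_action p (prune phi D) (rot_vertices p ^+ M)%g \in TRI p.
    elim: (M) => [|i IHi]; first by rewrite expg0 act1.
    by rewrite expgSr actM; apply: TRI_rot.
  by rewrite -[X in X == _](graftK _ dP') graftRot KD (eqP symD) eqxx.
- case=> D' /setIdP[triD' /andP[/eqP symD' /eqP cardD']] ->.
  rewrite in_set (in_set (fun _ => _ && _)) graftTRI //= -graftRot symD' eqxx.
  rewrite cardG cardR cardD' eqxx /=.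
  apply: (subsetP (graft_roots phiP _)) => //; exact: imset_f.
Qed.

End GraftCount.

Section LinearRecursion.

Variables (e m : nat).
Let M := m.+2.
Let p := e * M.
Let n := e * M.+1.
Hypothesis p_gt3 : 3 < p.

Let lt_x0 : m.+1 < p.
Proof. by move: p_gt3; rewrite /p /M; case: (e) => // e' _; rewrite mulSn leq_addr. Qed.
Let lt_x1 : m < p. Proof. exact: ltnW. Qed.
Let x0 : 'I_p := Ordinal lt_x0.
Let x1 : 'I_p := Ordinal lt_x1.

(** Grafting on the sides that start at M-1 modulo M kills the ears that start at
    M-1 and at M-2; both residues are distinct because M >= 2. *)
Lemma card_surviving_ears (D : {set {set 'I_p}}) :
  rot_action p D (rot_vertices p ^+ M)%g == D ->
  #|ear_starts D| =
  #|@surviving_ears e M D| + e * (x0 \in ear_starts D) + e * (x1 \in ear_starts D).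
Proof.
move=> /ear_starts_periodic per; set A := ear_starts D in per *.
pose R := skip_roots e M; pose R' := [set x | ordS x \in R].
have RE (x : 'I_p) : (x \in R) = (x %% M == x0 %% M).
  by rewrite inE /= [m.+1 %% _]modn_small.
have R'E (x : 'I_p) : (x \in R') = (x %% M == x1 %% M).
  rewrite !inE /= modn_dvdm ?dvdn_mull // -addn1 -modnDml.
  have : x %% M < M by rewrite ltn_mod.
  rewrite leq_eqVlt => /orP[/eqP[->]|lt_r].
    by rewrite addn1 modnn [m %% _]modn_small // /M; lia.
  rewrite addn1 modn_small // [m %% _]modn_small /M; lia.
rewrite -!card_periodic_residue // -(cardsID R A) -(cardsID R' (A :\: R)).
have -> : A :&: R = [set x in A | x %% M == x0 %% M].
  by apply/setP => x; rewrite in_setI RE [in RHS]inE.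
have -> : (A :\: R) :&: R' = [set x in A | x %% M == x1 %% M].
  apply/setP => x; rewrite in_setI in_setD R'E RE [in RHS]inE andbC.
  have [/eqP-> /=|_] := boolP (x %% M == x1 %% M); last by rewrite andbF.
  rewrite !modn_small /M; try lia; by rewrite andbT; case: eqP => //; lia.
have -> : (A :\: R) :\: R' = surviving_ears D.
  apply/setP => x; rewrite !in_setD (_ : (x \in R') = (ordS x \in R)); last by rewrite inE.
  by rewrite [RHS](in_set (fun y => _ && _)) -/A andbA andbC [(x \notin R) && _]andbC.
by rewrite addnA addnC addnA.
Qed.

Lemma card_TRI_sum (P Q : {set {set 'I_p}} -> bool) :
  #|[set D in TRI p | P D && Q D]| = \sum_(D in TRI p | P D) Q D.
Proof.
rewrite -sum1_card [RHS]big_mkcond [LHS]big_mkcond; apply: eq_bigr => D _.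
by rewrite (in_set (fun _ => _ && _)); case: (D \in TRI p); case: (P D); case: (Q D).
Qed.

(** As p > 3, consecutive vertices do not both start ears, so a glued side kills
    at most one ear, and the 2k sides that k ears have in common with the
    polygon are distinct.  The term 2k |sym_tri p M k| is on the left to avoid a
    subtraction. *)
Lemma sym_tri_rec k :
  p * ((k + e) * #|sym_tri n M.+1 (k + e)|) + n * (2 * k * #|sym_tri p M k|) =
  n * (2 * (k + e) * #|sym_tri p M (k + e)| + p * #|sym_tri p M k|).
Proof.
have M_gt0 : 0 < M by [].
rewrite (sym_tri_graft_count M_gt0) -?/p; last lia.
pose B k x := #|[set D in sym_tri p M k | x \in ear_starts D]|.
have BE k' x : k' * #|sym_tri p M k'| = p * B k' x by exact: sym_tri_double_count.
suff key : #|[set D in TRI p | (rot_action p D (rot_vertices p ^+ M)%g == D)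
    && (e + #|@surviving_ears e M D| == k + e)]| + B k x0 + B k x1 =
    B (k + e) x0 + B (k + e) x1 + #|sym_tri p M k|.
  have := BE (k + e) x0; have := BE (k + e) x1; have := BE k x0; have := BE k x1.
  move: key; set S := #|[set D in TRI p | _]|; set T := #|_|; set T' := #|_|.
  set a := B _ _; set b := B _ _; set c := B _ _; set d := B _ _.
  move=> key E1 E2 E3 E4.
  have -> : n * (2 * k * T) = n * (k * T + k * T) by lia.
  have -> : n * (2 * (k + e) * T' + p * T) = n * ((k + e) * T' + (k + e) * T' + p * T) by lia.
  rewrite {1}E1 {1}E2 {1}E3 E4 -!mulnDr [p * (n * _)]mulnCA -!mulnDr.
  by congr (n * (p * _)); lia.
have BS k' x : B k' x =
    \sum_(D in TRI p | rot_action p D (rot_vertices p ^+ M)%g == D)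
       ((#|ear_starts D| == k') && (x \in ear_starts D)).
  rewrite -card_TRI_sum; apply: eq_card => D.
  by rewrite !(in_set (fun _ => _ && _)) !andbA.
rewrite !BS !card_TRI_sum -!big_split /=; apply: eq_bigr => D /andP[triD symD].
have := card_surviving_ears symD.
have := ear_starts_not_consecutive p_gt3 triD (i := x1).
have -> : ordS x1 = x0 by apply: val_inj; rewrite /= modn_small.
case: (x0 \in _); case: (x1 \in _) => nc; first by have := nc isT.
all: rewrite ?andbT ?andbF; set E := #|_|; set v := #|_|; move=> Ev; lia.
Qed.

End LinearRecursion.

Lemma sym_tri_dvdn e M k : 0 < M -> ~~ (e %| k) -> #|sym_tri (e * M) M k| = 0.
Proof.
move=> M_gt0 ndvd; apply/eqP; rewrite cards_eq0; apply/eqP/setP => D.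
rewrite in_set0; apply/negP => /setIdP[_ /andP[/ear_starts_periodic per /eqP E]].
by case/negP: ndvd; rewrite -E; apply: dvdn_card_periodic.
Qed.

Lemma sym_tri0 n j : 3 < n -> #|sym_tri n j 0| = 0.
Proof.
move=> hn; apply/eqP; rewrite cards_eq0; apply/eqP/setP => D.
rewrite in_set0; apply/negP => /setIdP[/(ear_starts_neq0 hn) ne /andP[_]].
by rewrite cards_eq0 (negPf ne).
Qed.

Lemma TRI3 D : (D \in TRI 3) = (D == set0).
Proof.
have nodiag (e : {set 'I_3}) : is_diagonal e = false.
  apply/negP => de; have [a [b E]] := diagonal_set2 de; move: de.
  rewrite E is_diagonal_set2 -!val_eqE /=.
  by case: a {E} => [[|[|[|a]]] //= ?]; case: b => [[|[|[|b]]] //= ?].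
apply/idP/eqP => [/TRI_P[dD _ _]|->].
  by apply/setP => e; rewrite inE; apply/negP => /dD; rewrite nodiag.
apply/TRI_P; split=> [e|e f|e]; rewrite ?inE // nodiag //.
Qed.

Lemma ear_starts3 : ear_starts (set0 : {set {set 'I_3}}) = setT.
Proof.
apply/setP => x; rewrite !inE /adjacent is_side_set2 -!val_eqE /=.
by case: x => [[|[|[|a]]] //= ?].
Qed.

(** The triangle is the exception to the linear recursion: all its three vertices
    start ears, and a glued side kills two of them.  Here e = 1, M = 3 leaves one
    old ear, and e = 3, M = 1 none. *)
Lemma sym_tri_rec3 e M k : 0 < M -> e * M = 3 ->
  k * #|sym_tri (e * M.+1) M.+1 k| = e * M.+1 * (e + (M == 3) == k).
Proof.
move=> M_gt0 E3; rewrite (sym_tri_graft_count M_gt0) ?E3 //; congr (_ * _).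
have triE (D : {set {set 'I_(e * M)}}) : (D \in TRI (e * M)) = (D == set0).
  by move: D; rewrite E3; exact: TRI3.
have surv : #|@surviving_ears e M set0| = (M == 3).
  have [[-> ->]|[-> ->]] : (e = 1 /\ M = 3) \/ (e = 3 /\ M = 1).
    by move: E3 M_gt0; clear; case: e => [|[|[|[|e]]]]; rewrite ?mulSn; lia.
    rewrite -[RHS](cards1 (ord0 : 'I_(1 * 3))); apply: eq_card => x.
    rewrite in_set ear_starts3 !inE -!val_eqE /=.
    by case: x => [[|[|[|a]]] //= ?].
  apply: eq_card0 => x; rewrite in_set ear_starts3 !inE /=.
  by case: x => [[|[|[|a]]] //= ?].
case: eqP => [<-|ne].
  rewrite (eq_card (B := [set set0])) ?cards1 // => D.
  apply/setIdP/set1P => [[]|->]; first by rewrite triE => /eqP.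
  by rewrite triE surv !eqxx andbT; split => //; apply/eqP/imset0.
apply: eq_card0 => D; apply/negP => /setIdP[]; rewrite triE => /eqP->.
by rewrite surv => /andP[_ /eqP].
Qed.

(** Here t M c stands for the number of e-fold symmetric triangulations of the
    e M-gon with e c ears: d = 2 if e = 1, where the recursion starts at the
    square, and d = 1 if e = 2 or 3, where it starts at M = 2. *)
Lemma ear_recursion_solution d (t : nat -> nat -> nat) : 0 < d ->
  (forall c, t (2 * d) c * c`! = (c == d) * (2 * d)) ->
  (forall M, 2 * d <= M -> t M 0 = 0) ->
  (forall M c, 2 * d <= M ->
     M * (c.+1 * t M.+1 c.+1) + M.+1 * (2 * c * t M c) =
     M.+1 * (2 * c.+1 * t M c.+1 + M * t M c)) ->
  forall M c, 2 * d <= M ->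
  if (d <= c) && (2 * c <= M)
  then t M c * ((M - 2 * c)`! * c`! * (c - d)`!) =
       M * (M - 2 * d)`! * 2 ^ (M - 2 * c)
  else t M c = 0.
Proof.
move=> d_gt0 base t0 rec M c le_dM.
rewrite -(subnKC le_dM); elim: (M - 2 * d) c => [|i IH] c {M le_dM}.
  rewrite addn0 subnn; have := base c; have [->|ne] := eqVneq c d.
    by rewrite !leqnn !subnn /= mul1n !muln1 mul1n.
  rewrite mul0n (_ : _ && _ = false); last lia.
  by move/eqP; rewrite muln_eq0 => /orP[/eqP//|]; have := fact_gt0 c; lia.
rewrite addnS; set M := 2 * d + i in IH *; have le_dM : 2 * d <= M by lia.
case: c => [|c]; first by rewrite leqNgt d_gt0 t0 //; lia.
have M_gt0 : 0 < M by lia.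
have := rec M c le_dM; have := IH c; have := IH c.+1.
set a := t M.+1 c.+1; set b := t M c; set x := t M c.+1.
have zero : M * (c.+1 * a) = 0 -> a = 0.
  by move/eqP; rewrite !muln_eq0 => /or3P[|//|/eqP//]; lia.
have [lt_cd|le_dc] := ltnP c.+1 d.
  have -> : (d <= c) = false by lia.
  by move=> -> ->; rewrite !muln0 !addn0 => /zero.
have [lt_Mc|le_cM] := ltnP M.+1 (2 * c.+1).
  have -> : (2 * c.+1 <= M) = false by lia.
  rewrite !andbF; move=> -> hb; rewrite muln0 add0n => E; apply: zero; move: E.
  have [lt_Mb|le_bM] := ltnP M (2 * c).
    have F : (2 * c <= M) = false by lia.
    by rewrite F andbF in hb; rewrite hb !muln0 addn0.
  have -> : M = 2 * c by lia.
  by move/eqP; rewrite -[X in _ == X]add0n eqn_add2r => /eqP.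
rewrite /=; have [cE|lt_dc] := eqVneq c.+1 d.
  have -> : (d <= c) = false by lia.
  have -> : 2 * c.+1 <= M by lia.
  rewrite cE subnn /= => hx ->; rewrite !muln0 !addn0 => E.
  have {}hx : x * d`! = M * 2 ^ (M - 2 * d).
    move/eqP: hx; rewrite fact0 muln1 [M * _`!]mulnC -mulnA mulnCA.
    by rewrite eqn_pmul2l ?fact_gt0 // => /eqP.
  have -> : M.+1 - 2 * d = (M - 2 * d).+1 by lia.
  rewrite fact0 muln1 mulnCA [M.+1 * _`!]mulnC -mulnA; congr (_ * _).
  apply/eqP; rewrite -(eqn_pmul2l M_gt0) -(eqn_pmul2l d_gt0); apply/eqP.
  rewrite expnS; transitivity (M * (d * a) * d`!); first by ring.
  rewrite E; transitivity (M.+1 * (2 * d) * (x * d`!)); first by ring.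
  by rewrite hx; ring.
have {}le_dc : d <= c by lia.
rewrite le_dc /=.
have -> : 2 * c <= M by lia.
have [v cE] : exists v, c = d + v by exists (c - d); lia.
have vE : c - d = v by lia.
rewrite subSn // vE factS (factS v).
have [le_M|lt_M] := leqP (2 * c.+1) M.
  have [u ME] : exists u, M = 2 * c + 2 + u by exists (M - 2 * c.+1); lia.
  have -> : M.+1 - 2 * c.+1 = u.+1 by lia.
  have -> : M - 2 * c.+1 = u by lia.
  have -> : M - 2 * c = u.+2 by lia.
  have -> : M.+1 - 2 * d = (2 * v + 2 + u).+1 by lia.
  have -> : M - 2 * d = 2 * v + 2 + u by lia.
  rewrite (factS u) (factS u.+1) (factS (2 * v + 2 + u)) (factS u) !expnS.
  set P := (2 * v + 2 + u)`!; set Q := 2 ^ u => hx hb E.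
  have {}E : M * (c.+1 * a) = M.+1 * (2 * c.+1 * x + u.+2 * b).
    apply/eqP; rewrite -(eqn_add2r (M.+1 * (2 * c * b))) E {2}ME; apply/eqP; ring.
  apply/eqP; rewrite -(eqn_pmul2l M_gt0); apply/eqP.
  transitivity (M * (c.+1 * a) * (u.+1 * u`! * c`! * (v.+1 * v`!))); first by ring.
  rewrite E; transitivity (M.+1 * (2 * u.+1 * (x * (u`! * (c.+1 * c`!) * (v.+1 * v`!)))
      + v.+1 * (b * (u.+2 * (u.+1 * u`!) * c`! * v`!)))); first by ring.
  rewrite hx hb; ring.
have ME : M = (2 * c).+1 by lia.
move=> /= -> hb; rewrite muln0 add0n => E.
have -> : M.+1 - 2 * c.+1 = 0 by lia.
have -> : M.+1 - 2 * d = (2 * v).+2 by lia.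
move: hb; have -> : M - 2 * c = 1 by lia.
have -> : M - 2 * d = (2 * v).+1 by lia.
rewrite fact0 (_ : 1`! = 1) // (factS (2 * v).+1); set P := (2 * v).+1`! => hb.
have {}E : M * (c.+1 * a) = M.+1 * b.
  apply/eqP; rewrite -(eqn_add2r (M.+1 * (2 * c * b))) E {2}ME; apply/eqP; ring.
apply/eqP; rewrite -(eqn_pmul2l M_gt0); apply/eqP.
transitivity (M * (c.+1 * a) * (c`! * (v.+1 * v`!))); first by ring.
rewrite E; transitivity (M.+1 * (v.+1 * (b * (1 * c`! * v`!)))); first by ring.
rewrite hb; ring.
Qed.

Lemma sym_tri_rec_div e M c : 0 < e -> 1 < M -> 3 < e * M ->
  M * (c.+1 * #|sym_tri (e * M.+1) M.+1 (e * c.+1)|) +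
    M.+1 * (2 * c * #|sym_tri (e * M) M (e * c)|) =
  M.+1 * (2 * c.+1 * #|sym_tri (e * M) M (e * c.+1)| +
          M * #|sym_tri (e * M) M (e * c)|).
Proof.
case: M => [|[|m]] // e_gt0 _ hM.
have := sym_tri_rec hM (e * c).
have -> : e * c + e = e * c.+1 by rewrite mulnS addnC.
set a := #|_|; set b := #|_|; set d := #|_| => E.
have ee_gt0 : 0 < e * e by rewrite muln_gt0 e_gt0.
apply/eqP; rewrite -(eqn_pmul2l ee_gt0); apply/eqP.
transitivity (e * m.+2 * (e * c.+1 * a) + e * m.+3 * (2 * (e * c) * b)); first by ring.
rewrite E; ring.
Qed.

Lemma rot_expn n : (rot_vertices n ^+ n = 1)%g.
Proof.
by apply/permP => x; apply: val_inj; rewrite val_rotX perm1 modnDr modn_small.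
Qed.

Lemma sym_tri_trivial n k :
  #|sym_tri n n k| = #|[set D in TRI n | #|ear_starts D| == k]|.
Proof.
apply: eq_card => D.
by apply/setIdP/setIdP => -[triD]; rewrite rot_expn act1 eqxx.
Qed.

Lemma card_sym_tri4 c : #|sym_tri (1 * 4) 4 (1 * c)| * c`! = (c == 2) * 4.
Proof.
have := @sym_tri_rec3 1 3 c isT erefl; rewrite !mul1n.
case: c => [|c]; first by rewrite sym_tri0.
rewrite eq_sym /= ; case: eqP => [->|_]; first by rewrite mulnC => ->.
by rewrite muln0 => /eqP; rewrite muln_eq0 /= => /eqP->.
Qed.

Lemma card_TRI_ears M c : 4 <= M ->
  if (2 <= c) && (2 * c <= M)
  then #|sym_tri (1 * M) M (1 * c)| * ((M - 2 * c)`! * c`! * (c - 2)`!) =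
       M * (M - 4)`! * 2 ^ (M - 2 * c)
  else #|sym_tri (1 * M) M (1 * c)| = 0.
Proof.
apply: (@ear_recursion_solution 2 (fun M c => #|sym_tri (1 * M) M (1 * c)|)) => //.
- exact: card_sym_tri4.
- by move=> m hm; rewrite sym_tri0 // mul1n.
- by move=> m c' hm; apply: sym_tri_rec_div; lia.
Qed.

(** Both diagonals of the square are diameters. *)
Lemma rot2_TRI4 (D : {set {set 'I_4}}) : D \in TRI 4 ->
  rot_action 4 D (rot_vertices 4 ^+ 2)%g = D.
Proof.
case/TRI_P => dD _ _.
have fixed (e : {set 'I_4}) : is_diagonal e ->
    [set (rot_vertices 4 ^+ 2)%g x | x in e] = e.
  move=> de; have [a [b E]] := diagonal_set2 de; move: de.
  rewrite E is_diagonal_set2 imset2_eq -!val_eqE => dab.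
  suff [-> ->] : (rot_vertices 4 ^+ 2)%g a = b /\ (rot_vertices 4 ^+ 2)%g b = a.
    by rewrite setUC.
  move: dab; split; apply: val_inj; rewrite val_rotX; move: dab => /=;
  by case: a {E} => [[|[|[|[|a]]]] //= ?]; case: b => [[|[|[|[|b]]]] //= ?].
rewrite rot_actionE -[RHS]imset_id; apply: eq_in_imset => e De /=.
by rewrite fixed ?dD.
Qed.

Lemma card_central_sym_TRI4 c : #|sym_tri (2 * 2) 2 (2 * c)| * c`! = (c == 1) * 2.
Proof.
have -> : #|sym_tri (2 * 2) 2 (2 * c)| = #|sym_tri (1 * 4) 4 (1 * (2 * c))|.
  rewrite !mul1n sym_tri_trivial; apply: eq_card => D; apply/setIdP/setIdP.
    by case=> triD /andP[_ ->].
  by case=> triD ->; split => //; rewrite rot2_TRI4 ?eqxx.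
have := card_sym_tri4 (2 * c); case: c => [|[|c]].
- by rewrite muln0 => ->.
- by rewrite muln1 /= => E; move: E; rewrite (_ : 2`! = 2) // (_ : 1`! = 1) //; lia.
- rewrite (_ : (2 * c.+2 == 2) = false); last lia.
  by move/eqP; rewrite muln_eq0 => /orP[/eqP->//|]; have := fact_gt0 (2 * c.+2); lia.
Qed.

(** Half-turn symmetry; the smallest case is the square. *)
Lemma card_central_sym_TRI M c : 2 <= M ->
  if (1 <= c) && (2 * c <= M)
  then #|sym_tri (2 * M) M (2 * c)| * ((M - 2 * c)`! * c`! * (c - 1)`!) =
       M * (M - 2)`! * 2 ^ (M - 2 * c)
  else #|sym_tri (2 * M) M (2 * c)| = 0.
Proof.
apply: (@ear_recursion_solution 1 (fun M c => #|sym_tri (2 * M) M (2 * c)|)) => //.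
- exact: card_central_sym_TRI4.
- by move=> m hm; rewrite muln0 sym_tri0 //; lia.
- by move=> m c' hm; apply: sym_tri_rec_div; lia.
Qed.

(** Symmetry of order three; the smallest case is the hexagon. *)
Lemma card_triple_sym_TRI M c : 2 <= M ->
  if (1 <= c) && (2 * c <= M)
  then #|sym_tri (3 * M) M (3 * c)| * ((M - 2 * c)`! * c`! * (c - 1)`!) =
       M * (M - 2)`! * 2 ^ (M - 2 * c)
  else #|sym_tri (3 * M) M (3 * c)| = 0.
Proof.
apply: (@ear_recursion_solution 1 (fun M c => #|sym_tri (3 * M) M (3 * c)|)) => //.
- move=> {M} {}c; have := @sym_tri_rec3 3 1 (3 * c) isT erefl.
  case: c => [|[|c]]; first by rewrite muln0 sym_tri0.
    move=> E; have {}E : 3 * #|sym_tri (3 * 2) 2 (3 * 1)| = 6 by exact: E.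
    by change (#|sym_tri (3 * 2) 2 (3 * 1)| * 1 = 2); lia.
  rewrite (_ : (3 + (1 == 3) == 3 * c.+2) = false); last lia.
  by rewrite muln0 mul0n => /eqP; rewrite muln_eq0 => /orP[|/eqP->]; [lia|].
- by move=> m hm; rewrite muln0 sym_tri0 //; lia.
- by move=> m c' hm; apply: sym_tri_rec_div; lia.
Qed.

(** Cutting off orbits of ears descends to M = 1, where the ear starts are
    invariant under rotation by one step, so that there are consecutive ones. *)
Lemma no_highly_symmetric_TRI e M k : 3 < e -> 0 < M ->
  #|sym_tri (e * M) M k| = 0.
Proof.
move=> he hM; suff none (D : {set {set 'I_(e * M)}}) : D \in TRI (e * M) ->
    rot_action _ D (rot_vertices (e * M) ^+ M)%g == D -> False.
  by apply: eq_card0 => D; apply/negP => /setIdP[triD /andP[/(none D triD)]].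
elim: M hM D => // -[|M] IH _ D triD symD.
  have n_gt3 : 3 < e * 1 by rewrite muln1.
  have /set0Pn[x earx] := ear_starts_neq0 n_gt3 triD.
  have := ear_starts_not_consecutive n_gt3 triD earx.
  have := ear_starts_periodic symD x; rewrite expg1 rot_verticesE => ->.
  by rewrite earx.
have n_gt3 : 3 < e * M.+2 by nia.
have := ear_starts_neq0 n_gt3 triD; rewrite -card_gt0.
have := @sym_tri_graft_count e M.+1 isT _ #|ear_starts D|.
have -> : 2 < e * M.+1 by nia.
move=> /(_ isT); rewrite [X in _ = _ * X]eq_card0 ?muln0.
  move=> /eqP; rewrite muln_eq0 => /orP[/eqP->//|].
  rewrite cards_eq0 => /eqP/setP/(_ D); rewrite in_set0 => + _.
  by move=> h; have : D \in sym_tri (e * M.+2) M.+2 #|ear_starts D|;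
    [apply/setIdP; rewrite triD symD eqxx | rewrite h].
by move=> D'; apply/negP => /setIdP[triD' /andP[symD' _]]; apply: (IH isT D').
Qed.

Import Order.TTheory GRing.Theory Num.Theory.
Local Open Scope ring_scope.

(** * Gaussian binomial coefficients *)

(** The Pascal recursion makes sense in every ring, in particular at roots of
    unity, where the quotient of q-factorials does not. *)
Fixpoint gauss (R : pzRingType) (q : R) (m r : nat) : R :=
  match m, r with
  | _, 0 => 1
  | 0, _.+1 => 0
  | m'.+1, r'.+1 => q ^+ (m' - r') * gauss q m' r' + gauss q m' r'.+1
  end.

Arguments gauss R q m r : simpl never.

Section Gauss.

Variables (R : comPzRingType) (q : R).

Lemma gauss0 m : gauss q m 0 = 1. Proof. by case: m. Qed.

Lemma gauss0l r : gauss q 0 r = (r == 0)%:R. Proof. by case: r. Qed.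

Lemma gaussS m r :
  gauss q m.+1 r.+1 = q ^+ (m - r) * gauss q m r + gauss q m r.+1.
Proof. by []. Qed.

Lemma gauss_small m r : (m < r)%N -> gauss q m r = 0.
Proof.
elim: m r => [|m IH] [|r] // lt_mr.
by rewrite gaussS !IH ?mulr0 ?addr0 // ltnW.
Qed.

Lemma gaussnn m : gauss q m m = 1.
Proof.
elim: m => // m IH; by rewrite gaussS subnn expr0 mul1r IH gauss_small ?addr0.
Qed.

(** Of the two Pascal rules, the one in the definition of gauss matches the
    induction on n term by term. *)
Lemma gauss_Vandermonde m n r : gauss q (m + n) r =
  \sum_(i < r.+1) q ^+ ((m - i) * (r - i)) * gauss q m i * gauss q n (r - i).
Proof.
elim: n r => [|n IH] r.
  rewrite addn0; under eq_bigr do rewrite gauss0l.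
  rewrite big_ord_recr /= subnn muln0 expr0 mul1r mulr1.
  by rewrite big1 ?add0r // => i _; rewrite subn_eq0 leqNgt ltn_ord mulr0.
case: r => [|r].
  by rewrite big_ord_recl big_ord0 subnn muln0 expr0 !gauss0 !mul1r addr0.
rewrite addnS gaussS !IH big_distrr /= [in RHS]big_ord_recr /= subnn gauss0.
rewrite [X in _ + X = _]big_ord_recr /= subnn gauss0 addrA; congr (_ + _).
rewrite -big_split /=; apply: eq_bigr => i _.
have le_ir : (i <= r)%N by rewrite -ltnS.
rewrite subSn // gaussS mulrDr; congr (_ + _).
have [lt_mi|le_im] := ltnP m i; first by rewrite (gauss_small lt_mi) !(mul0r, mulr0).
have [lt_n|le_n] := ltnP n (r - i); first by rewrite (gauss_small lt_n) !mulr0.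
rewrite [RHS]mulrACA -[X in _ * X]mulrA mulrA -!exprD.
congr (q ^+ _ * _); rewrite mulnS; lia.
Qed.

End Gauss.

(** * The recursion for Cat(n-2) / [n] *)

(** The q-analogues are taken at an element q of an arbitrary field in which no
    q-integer vanishes; ratfun with its variable is an instance by conversion. *)
Section QAnalogues.

Variables (F : fieldType) (q : F).

Definition gint (m : nat) : F := \sum_(i < m) q ^+ i.

Definition gfact (m : nat) : F := \prod_(i < m) gint i.+1.

Definition gbinom (m r : nat) : F :=
  if (r <= m)%N then gfact m / (gfact r * gfact (m - r)) else 0.

Definition gCat (m : nat) : F := (gint m.+1)^-1 * gbinom (2 * m) m.

Definition gTri (n k : nat) : F :=
  q ^+ (k * (k - 2)) * (gint n / gint k) * gbinom (n - 4) (2 * k - 4)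
  * gCat (k - 2)
  * (\sum_(0 <= j < (n - 2 * k).+1) q ^+ (j * (n - 2)) * gbinom (n - 2 * k) j).

Hypothesis gint_neq0 : forall m, (0 < m)%N -> gint m != 0.

Lemma gintS m : gint m.+1 = gint m + q ^+ m.
Proof. by rewrite /gint big_ord_recr. Qed.

Lemma gint0 : gint 0 = 0. Proof. by rewrite /gint big_ord0. Qed.

Lemma gint1 : gint 1 = 1. Proof. by rewrite gintS gint0 add0r. Qed.

Lemma gintD a b : gint (a + b) = gint a + q ^+ a * gint b.
Proof.
elim: b => [|b IH]; first by rewrite addn0 gint0 mulr0 addr0.
by rewrite addnS !gintS IH mulrDr addrA exprD.
Qed.

Lemma gint_mul a b : gint (b * a) = gint a * \sum_(i < b) q ^+ (i * a).
Proof.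
elim: b => [|b IH]; first by rewrite mul0n big_ord0 mulr0 gint0.
by rewrite big_ord_recr mulrDr -IH mulSn addnC gintD [q ^+ _ * _]mulrC.
Qed.

Lemma gfactS m : gfact m.+1 = gfact m * gint m.+1.
Proof. by rewrite /gfact big_ord_recr. Qed.

Lemma gfact0 : gfact 0 = 1. Proof. by rewrite /gfact big_ord0. Qed.

Lemma gfact_neq0 m : gfact m != 0.
Proof. by apply/prodf_neq0 => i _; apply: gint_neq0. Qed.

Lemma gbinom_gauss m r : gbinom m r = gauss q m r.
Proof.
elim: m r => [|m IH] [|r]; rewrite /gbinom ?leq0n ?subn0 ?gfact0 ?mul1r ?gauss0
  ?divff ?gfact_neq0 ?invr1 //.
rewrite gaussS -!IH /gbinom ltnS; have [le_rm|lt_mr] := leqP r m; last first.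
  by rewrite ltnNge ltnW // mulr0 addr0.
have nz := gfact_neq0; have nzi := gint_neq0.
rewrite subSS; have [lt_rm|le_mr] := ltnP r m; last first.
  have -> : r = m by lia.
  by rewrite subnn expr0 gfact0 !mulr1 !divff // ?addr0 ?mulr1.
have [d ->] : exists d, m = (r + d.+1)%N by exists (m - r.+1)%N; lia.
rewrite addKn (_ : (r + d.+1 - r.+1 = d)%N); last lia.
have -> : gfact (r + d.+1).+1 =
    gfact (r + d.+1) * (gint d.+1 + q ^+ d.+1 * gint r.+1).
  by rewrite gfactS -gintD; congr (_ * gint _); lia.
rewrite (gfactS r) (gfactS d); set X := gfact (r + d.+1); set y := q ^+ d.+1.
have := nz r; have := nz d; have := nzi d.+1 isT; have := nzi r.+1 isT.
move=> h1 h2 h3 h4; field; by rewrite h1 h2 h3 h4.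
Qed.

Lemma gbinom_fact m r : (r <= m)%N ->
  gbinom m r = gfact m / (gfact r * gfact (m - r)).
Proof. by rewrite /gbinom => ->. Qed.

Definition rogers_szego (s : nat) (x : F) : F :=
  \sum_(0 <= j < s.+1) x ^+ j * gbinom s j.

(** At q = 1 this is the number of triangulations of the n-gon divided by n. *)
Definition tri_weight (n : nat) : F := gCat (n - 2) / gint n.

Lemma tri_weight_fact n : (2 <= n)%N ->
  tri_weight n = gfact (2 * n - 4) / (gfact n * gfact (n - 2)).
Proof.
case: n => [|[|n]] // _; rewrite /tri_weight /gCat gbinom_fact; last lia.
rewrite (_ : (2 * n.+2 - 4 = 2 * n)%N); last lia.
rewrite !subn2 /= (_ : (2 * n - n = n)%N); last lia.
have := gfact_neq0 n; have := gint_neq0 (ltn0Sn n); have := gint_neq0 (ltn0Sn n.+1).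
by rewrite !gfactS => h1 h2 h3; field; rewrite h1 h2 h3.
Qed.

Definition tri_summand (n k : nat) : F :=
  q ^+ (k * (k - 2)) * gbinom (n - 4) (n - 2 * k) * tri_weight k
  * rogers_szego (n - 2 * k) (q ^+ (n - 2)).

Lemma gTriE n k : (2 <= k)%N -> (2 * k <= n)%N ->
  gTri n k = gint n * tri_summand n k.
Proof.
move=> hk hn; rewrite /gTri /tri_summand /tri_weight.
have -> : gbinom (n - 4) (2 * k - 4) = gbinom (n - 4) (n - 2 * k).
  rewrite /gbinom (_ : (n - 4 - (2 * k - 4) = n - 2 * k)%N); last lia.
  rewrite (_ : (n - 4 - (n - 2 * k) = 2 * k - 4)%N); last lia.
  by rewrite [gfact (n - 2 * k) * _]mulrC !ifT //; lia.
have -> : \sum_(0 <= j < (n - 2 * k).+1) q ^+ (j * (n - 2)) * gbinom (n - 2 * k) j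
    = rogers_szego (n - 2 * k) (q ^+ (n - 2)).
  by apply: eq_bigr => j _; rewrite -exprM mulnC.
ring.
Qed.

(** The summation index is p = k + j, with j the index of the Rogers-Szego sum. *)
Lemma tri_summand_fact n k : (2 <= k)%N -> (2 * k <= n)%N ->
  tri_summand n k = gfact (n - 4) *
  \sum_(0 <= p < n.+1 | (k <= p <= n - k)%N)
     q ^+ (p * (p - 2) + (p - k) * (n - p - k))
     / (gfact (p - k) * gfact k * gfact (n - p - k) * gfact (k - 2)).
Proof.
move=> hk hn; rewrite /tri_summand tri_weight_fact // gbinom_fact; last lia.
rewrite (_ : (n - 4 - (n - 2 * k) = 2 * k - 4)%N); last lia.
transitivity (gfact (n - 4) *
  \sum_(k <= p < (n - k).+1)
     q ^+ (p * (p - 2) + (p - k) * (n - p - k))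
     / (gfact (p - k) * gfact k * gfact (n - p - k) * gfact (k - 2))).
  rewrite -[X in \sum_(X <= _ < _) _]add0n big_addn /rogers_szego.
  rewrite (_ : ((n - k).+1 - k = (n - 2 * k).+1)%N); last lia.
  rewrite !big_distrr /= [in LHS]big_nat [in RHS]big_nat; apply: eq_bigr => j /andP[_ hj].
  rewrite addnK gbinom_fact; last lia.
  rewrite (_ : (n - (j + k) - k = n - 2 * k - j)%N); last lia.
  rewrite (_ : ((j + k) * (j + k - 2) + j * (n - 2 * k - j) =
    k * (k - 2) + (n - 2) * j)%N); last first.
    have [a ak] : exists a, k = (a + 2)%N by exists (k - 2)%N; lia.
    rewrite {}ak in hn hj *.
    have -> : (n - 2 * (a + 2) - j = n - 2 - (2 * a + 2 + j))%N by lia.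
    have [b ->] : exists b, (n - 2 = 2 * a + 2 + j + b)%N.
      by exists (n - 2 - (2 * a + 2 + j))%N; lia.
    by rewrite addnA !addnK addKn; ring.
  rewrite -exprM exprD.
  have := gfact_neq0 (2 * k - 4); have := gfact_neq0 k; have := gfact_neq0 (k - 2).
  have := gfact_neq0 (n - 2 * k); have := gfact_neq0 j; have := gfact_neq0 (n - 2 * k - j).
  by move=> h1 h2 h3 h4 h5 h6; field; rewrite h1 h2 h3 h4 h5 h6.
congr (_ * _); rewrite (big_nat_widen _ _ n.+1); last lia.
rewrite (big_nat_widenl _ 0) //=.
by apply: eq_bigl => p /=; lia.
Qed.

(** For fixed p, the sum over k is the q-Vandermonde sum for
    [p + (n-2-p); n-p]. *)
Lemma gTri_sum_exchange n : (4 <= n)%N ->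
  \sum_(2 <= k < n.+1 | (2 * k <= n)%N) tri_summand n k = gfact (n - 4) *
  \sum_(2 <= p < n.-1) q ^+ (p * (p - 2)) / (gfact p * gfact (n - 2 - p))
     * gbinom (n - 2) (n - p).
Proof.
move=> hn.
transitivity (\sum_(2 <= k < n.+1 | (2 * k <= n)%N) gfact (n - 4) *
  \sum_(0 <= p < n.+1 | (k <= p <= n - k)%N)
     q ^+ (p * (p - 2) + (p - k) * (n - p - k))
     / (gfact (p - k) * gfact k * gfact (n - p - k) * gfact (k - 2))).
  rewrite [LHS]big_nat_cond [RHS]big_nat_cond; apply: eq_bigr => k /andP[/andP[h2 _] h].
  exact: tri_summand_fact.
rewrite -big_distrr /=; congr (_ * _).
rewrite (exchange_big_dep_nat (fun p => 2 <= p < n.-1)%N) /=; last by move=> k p; lia.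
rewrite [RHS](big_nat_widen _ _ n.+1); last lia.
rewrite [RHS](big_nat_widenl _ 0) //=.
apply: eq_big => [p|p /andP[p2 pn]]; first by lia.
(* Both sums are extended to 0 <= k < n + 1; the terms added vanish. *)
have -> : (n - 2 = p + (n - p - 2))%N by lia.
rewrite gbinom_gauss gauss_Vandermonde big_distrr /= addKn.
rewrite -(big_mkord predT (fun i => q ^+ (p * (p - 2)) / (gfact p * gfact (n - p - 2)) *
   (q ^+ ((p - i) * (n - p - i)) * gauss q p i * gauss q (n - p - 2) (n - p - i)))).
rewrite [LHS](big_nat_widenl _ 0) //= [RHS](big_nat_widen _ _ n.+1) /=; last lia.
rewrite big_mkcond [RHS]big_mkcond /=; apply: eq_bigr => k _.
rewrite -!gbinom_gauss.
have [lt_pk|le_kp] := ltnP p k.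
  have -> : gbinom p k = 0 by rewrite /gbinom leqNgt lt_pk.
  rewrite mulr0 mul0r mulr0 if_same; case: ifP => //; lia.
have [lt_k2|le_2k] := ltnP k 2.
  have -> : gbinom (n - p - 2) (n - p - k) = 0 by rewrite /gbinom ifF //; lia.
  rewrite !mulr0 if_same; case: ifP => //; lia.
case: ifP => [c1|c1]; case: ifP => [c2|c2] //; try lia.
rewrite !gbinom_fact; try lia.
rewrite (_ : (n - p - 2 - (n - p - k) = k - 2)%N); last lia.
rewrite exprD.
have := gfact_neq0 p; have := gfact_neq0 k; have := gfact_neq0 (k - 2).
have := gfact_neq0 (p - k); have := gfact_neq0 (n - p - 2); have := gfact_neq0 (n - p - k).
by move=> h1 h2 h3 h4 h5 h6; field; rewrite h1 h2 h3 h4 h5 h6.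
Qed.

(** The sum over p that is left is the q-Vandermonde sum for [2M; M+2], where
    M = n-2, read backwards. *)
Lemma tri_weight_rec n : (4 <= n)%N ->
  tri_weight n = \sum_(2 <= k < n.+1 | (2 * k <= n)%N) tri_summand n k.
Proof.
move=> hn; rewrite gTri_sum_exchange // tri_weight_fact; last lia.
have [M nM] : exists M, n = (M + 2)%N by exists (n - 2)%N; lia.
rewrite nM addnK addn2 /= (_ : (2 * M.+2 - 4 = M + M)%N); last lia.
have E : gfact (M + M) / (gfact M.+2 * gfact (M - 2)) =
    \sum_(2 <= p < M.+1) q ^+ (p * (p - 2)) * gbinom M p * gbinom M (M.+2 - p).
  have <- : gbinom (M + M) M.+2 = gfact (M + M) / (gfact M.+2 * gfact (M - 2)).
    rewrite gbinom_fact; last lia.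
    by rewrite (_ : (M + M - M.+2 = M - 2)%N); last lia.
  rewrite gbinom_gauss gauss_Vandermonde -(big_mkord predT (fun i =>
    q ^+ ((M - i) * (M.+2 - i)) * gauss q M i * gauss q M (M.+2 - i))).
  (* The terms with i < 2 vanish since M + 2 - i > M. *)
  rewrite (big_cat_nat _ (n := 2)) //= big_nat [X in X + _]big1 => [|i /andP[_ lti]]; last first.
    by rewrite [gauss q M (_ - _)]gauss_small ?mulr0 //; lia.
  rewrite add0r (big_cat_nat _ (n := M.+1)) //=; try lia.
  rewrite [X in _ + X]big_nat [X in _ + X]big1 ?addr0 => [|i /andP[lti _]]; last first.
    by rewrite [gauss q M i]gauss_small ?mulr0 ?mul0r //; lia.
  rewrite big_nat_rev [LHS]big_nat [RHS]big_nat; apply: eq_bigr => i /andP[i2 iM].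
  rewrite !gbinom_gauss (_ : (2 + M.+1 - i.+1 = M.+2 - i)%N); last lia.
  rewrite (_ : (M.+2 - (M.+2 - i) = i)%N); last lia.
  rewrite (_ : (M - (M.+2 - i) = i - 2)%N); last lia.
  by rewrite mulnC mulrAC.
transitivity (gfact (M - 2) / gfact M * (gfact (M + M) / (gfact M.+2 * gfact (M - 2)))).
  have := gfact_neq0 M; have := gfact_neq0 M.+2; have := gfact_neq0 (M - 2).
  by move=> h1 h2 h3; field; rewrite h1 h2 h3.
rewrite E subn2 (_ : (M.+2 - 4 = M - 2)%N) /=; last lia.
rewrite -mulrA; congr (_ * _); first by rewrite subn2.
rewrite big_distrr /= [LHS]big_nat [RHS]big_nat.
apply: eq_bigr => p /andP[p2 pM].
rewrite (gbinom_fact (r := p)); last lia.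
have := gfact_neq0 M; have := gfact_neq0 p; have := gfact_neq0 (M - p).
by move=> h1 h2 h3; field; rewrite h1 h2 h3.
Qed.

Lemma gTri_sum n : (4 <= n)%N ->
  \sum_(2 <= k < n.+1 | (2 * k <= n)%N) gTri n k = gCat (n - 2).
Proof.
move=> hn; have nz : gint n != 0 by apply: gint_neq0; lia.
rewrite big_nat_cond (eq_bigr (fun k => gint n * tri_summand n k)); last first.
  by move=> k /andP[/andP[h2 _] hk]; apply: gTriE.
rewrite -big_nat_cond -big_distrr /= -tri_weight_rec // /tri_weight.
by rewrite mulrCA divff // mulr1.
Qed.

End QAnalogues.

(** * Nonnegative coefficients *)

(** N is any subsemiring that contains q; for the polynomials in q with
    nonnegative coefficients, membership in N is the claim. *)
Section Positivity.

Variables (F : fieldType) (q : F) (N : F -> Prop).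
Hypothesis gint_neq0 : forall m, (0 < m)%N -> gint q m != 0.
Hypotheses (N0 : N 0) (N1 : N 1) (Nq : N q).
Hypotheses (ND : forall x y, N x -> N y -> N (x + y))
           (NM : forall x y, N x -> N y -> N (x * y)).

Local Notation gint := (gint q).
Local Notation gauss := (gauss q).
Local Notation weight := (tri_weight q).

Lemma N_sum (I : Type) (r : seq I) (P : pred I) (f : I -> F) :
  (forall i, P i -> N (f i)) -> N (\sum_(i <- r | P i) f i).
Proof. by move=> Nf; elim/big_ind: _. Qed.

Lemma N_exp x i : N x -> N (x ^+ i).
Proof. by move=> Nx; elim: i => [|i IH]; rewrite ?expr0 // exprS; apply: NM. Qed.

Lemma N_gint m : N (gint m).
Proof. by apply: N_sum => i _; apply: N_exp. Qed.

Lemma N_gauss m r : N (gauss m r).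
Proof.
elim: m r => [|m IH] [|r]; rewrite ?gauss0 ?gauss0l //.
by rewrite gaussS; apply: ND => //; apply: NM => //; apply: N_exp.
Qed.

Lemma gint_dvd a m : (a %| m)%N -> exists2 y, N y & gint m = gint a * y.
Proof.
case/dvdnP => b ->; exists (\sum_(i < b) q ^+ (i * a)); last exact: gint_mul.
by apply: N_sum => i _; apply: N_exp.
Qed.

(** Split a set of size a into blocks of size d and a rest of size a mod d.  A
    subset of size b cannot consist of whole blocks and part of the rest, so
    some block is met properly; the first such block contributes a factor
    [d; i] with 0 < i < d, a multiple of [d].  The induction peels blocks off one
    at a time. *)
Lemma gauss_dvd d : (0 < d)%N ->
  (forall i, (0 < i < d)%N -> exists2 y, N y & gauss d i = gint d * y) ->
  forall a b, (a %% d < b %% d)%N -> exists2 y, N y & gauss a b = gint d * y.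
Proof.
move=> d_gt0 Nd a b; rewrite {2}(divn_eq a d); elim: (a %/ d)%N b => [|u IH] b.
  move=> lt_ab; exists 0 => //; rewrite mul0n add0n gauss_small ?mulr0 //.
  exact: leq_trans lt_ab (leq_mod _ _).
move=> lt_ab; rewrite mulSn -addnA gauss_Vandermonde.
have term (i : 'I_b.+1) : exists y, N y /\ q ^+ ((d - i) * (b - i)) *
    gauss d i * gauss (u * d + a %% d) (b - i) = gint d * y.
  have Ne := N_exp ((d - i) * (b - i)) Nq.
  have [i0|i_gt0] := posnP i.
    rewrite i0 !subn0 in Ne *; have [y Ny ->] := IH b lt_ab.
    exists (q ^+ (d * b) * y); split; first exact: NM.
    by rewrite gauss0 mulr1 mulrCA.
  have [lt_id|] := ltnP i d.
    have [|y Ny ->] := Nd i; first by rewrite i_gt0.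
    exists (q ^+ ((d - i) * (b - i)) * y * gauss (u * d + a %% d) (b - i)).
    by split; [apply: NM (N_gauss _ _); apply: NM | rewrite mulrCA !mulrA].
  rewrite leq_eqVlt => /orP[/eqP di|lt_di].
    have le_ib : (i <= b)%N by rewrite -ltnS.
    have [|y Ny ->] := IH (b - i)%N; last first.
      by exists y; split; rewrite // -di gaussnn subnn expr0 !mul1r.
    by rewrite -(modnDr (b - i)) di subnK // -di.
  by exists 0; split => //; rewrite (gauss_small _ lt_di) mulr0 mul0r mulr0.
have [f Nf] := fin_all_exists term; exists (\sum_i f i).
  by apply: N_sum => i _; case: (Nf i).
by rewrite mulr_sumr; apply: eq_bigr => i _; case: (Nf i).
Qed.

Lemma gint2 : gint 2 = 1 + q.
Proof. by rewrite !gintS gint0 expr0 expr1 add0r. Qed.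

Lemma gint3 : gint 3 = 1 + q + q ^+ 2.
Proof. by rewrite gintS gint2. Qed.

Lemma gauss_dvd2 a b : ~~ odd a -> odd b ->
  exists2 y, N y & gauss a b = gint 2 * y.
Proof.
move=> ha hb; apply: gauss_dvd => //; last by rewrite !modn2 hb (negPf ha).
case=> [|[|i]] // _; exists 1 => //.
by rewrite !gaussS !gauss0 !gauss0l gint2 /=; ring.
Qed.

Lemma gauss_dvd3 a b : (a %% 3 < b %% 3)%N ->
  exists2 y, N y & gauss a b = gint 3 * y.
Proof.
apply: gauss_dvd => //; case=> [|[|[|i]]] // _; exists 1 => //;
by rewrite !gaussS !gauss0 !gauss0l gint3 /=; ring.
Qed.

(** The second Pascal rule, from the Vandermonde sum for 1 + t. *)
Lemma gauss_rec2 t r :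
  gauss t.+1 r.+1 = gauss t r + q ^+ r.+1 * gauss t r.+1.
Proof.
rewrite -add1n gauss_Vandermonde !big_ord_recl big1 => [|i _]; last first.
  by rewrite [gauss 1 _]gauss_small // mulr0 mul0r.
rewrite (_ : nat_of_ord (lift ord0 ord0) = 1%N) // (_ : nat_of_ord ord0 = 0%N) //.
by rewrite !subSS !subn0 mul1n mul0n gauss0 gaussnn expr0 !mulr1 !mul1r addr0 addrC.
Qed.

Lemma rogers_szegoS t x : rogers_szego q t.+1 x =
  \sum_(0 <= j < t.+1) gauss t j * x ^+ j * (q ^+ j + x).
Proof.
rewrite /rogers_szego big_nat_recl //= gbinom_gauss // gauss0 expr0 mulr1.
transitivity (\sum_(0 <= j < t.+1) gauss t j * x ^+ j * x +
  (1 + \sum_(0 <= j < t.+1) gauss t j.+1 * x ^+ j.+1 * q ^+ j.+1)).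
  rewrite addrCA -big_split /=; congr (_ + _); apply: eq_bigr => j _.
  by rewrite gbinom_gauss // gauss_rec2 exprS; ring.
rewrite (_ : 1 + _ = \sum_(0 <= j < t.+2) gauss t j * x ^+ j * q ^+ j); last first.
  by rewrite [RHS]big_nat_recl //= gauss0 !expr0 !mulr1.
rewrite [X in _ + X]big_nat_recr //= gauss_small // !mul0r addr0 -big_split /=.
by apply: eq_bigr => j _; rewrite mulrDr addrC.
Qed.

(** K(k) itself is in general not a polynomial, and where it is one, it can have
    negative coefficients: K(5) = 1 - q + q^2. *)
Definition weight_claim (k : nat) : Prop :=
  if (3 %| k)%N then N (gint 2 * gint 3 * weight k) /\ N (gint 6 * weight k)
  else N (gint 2 * weight k).

(** If 3 divides k but not n, then the extra [3] comes from the Gaussian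
    coefficient: n-4 has a smaller residue modulo 3 than n-2k. *)
Lemma N_two_weight_binom n k : (2 <= k)%N -> (2 * k <= n)%N ->
  weight_claim k -> ~~ ((3 %| k) && (3 %| n))%N ->
  N (gint 2 * weight k * gauss (n - 4) (n - 2 * k)).
Proof.
rewrite /weight_claim => hk hn; case: ifP => /= [k3 [Nk _] n3|_ Nk _]; last first.
  exact: NM (N_gauss _ _).
have [|y Ny ->] := @gauss_dvd3 (n - 4) (n - 2 * k); first by lia.
rewrite [X in N X](_ : _ = gint 2 * gint 3 * weight k * y); first exact: NM.
ring.
Qed.

Lemma N_rogers_szego s i : N (rogers_szego q s (q ^+ i)).
Proof.
apply: N_sum => j _; rewrite gbinom_gauss //; apply: NM (N_gauss _ _).
by rewrite -exprM; apply: N_exp.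
Qed.

(** Strong induction along tri_weight_rec, whose summands have k <= n/2. *)
Lemma N_weight n : (2 <= n)%N -> weight_claim n.
Proof.
elim/ltn_ind: n => n IH hn.
have [hn4|] := leqP 4 n; last first.
  have g1 : gfact q 1 = 1 by rewrite gfactS gfact0 gint1 mulr1.
  have g2 : gfact q 2 = gint 2 by rewrite gfactS g1 mul1r.
  have nz2 := gint_neq0 (isT : (0 < 2)%N); have nz3 := gint_neq0 (isT : (0 < 3)%N).
  case: n hn {IH} => [|[|[|[|n]]]] //= _ _; rewrite /weight_claim /= tri_weight_fact //=.
    by rewrite gfact0 g2 mulr1 mulrA mulr1 divff.
  rewrite gfactS g2 g1; have [y Ny ->] := @gint_dvd 3 6 isT; split.
    rewrite [X in N X](_ : _ = gint 2); first exact: N_gint.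
    by field; rewrite nz2 nz3.
  rewrite [X in N X](_ : _ = y) //; by field; rewrite nz2 nz3.
have split_sum c : (forall k, (2 <= k)%N -> (2 * k <= n)%N ->
    N (c * weight k * gauss (n - 4) (n - 2 * k))) -> N (c * weight n).
  move=> Nc; rewrite tri_weight_rec // big_distrr /= big_nat_cond.
  apply: N_sum => k /andP[/andP[h2 _] hk]; rewrite /tri_summand gbinom_gauss //.
  rewrite [X in N X](_ : _ = q ^+ (k * (k - 2)) * (c * weight k * gauss (n - 4) (n - 2 * k)) *
     rogers_szego q (n - 2 * k) (q ^+ (n - 2))); last by ring.
  by apply: NM (N_rogers_szego _ _); apply: NM (Nc _ _ _) => //; apply: N_exp.
have claim k : (2 <= k)%N -> (2 * k <= n)%N -> weight_claim k.
  by move=> h2 hk; apply: IH => //; lia.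
rewrite /weight_claim; case: ifP => [n3|n3]; last first.
  by apply: split_sum => k h2 hk; apply: N_two_weight_binom; rewrite ?n3 ?andbF //; apply: claim.
split; apply: split_sum => k h2 hk; apply: NM (N_gauss _ _);
  have := claim k h2 hk; rewrite /weight_claim; case: ifP => _ //.
- by case.
- by move=> Nk; rewrite [gint 2 * _]mulrC -mulrA; apply: NM => //; apply: N_gint.
- by case.
- move=> Nk; have [y Ny ->] := @gint_dvd 2 6 isT.
  by rewrite mulrAC; apply: NM.
Qed.

(** For odd n and c, both q-integers on the right are divisible by [2]. *)
Lemma gint_mul_evenly n c : (c <= n)%N ->
  gint n * (1 + q ^+ c) = gint (n + c) + q ^+ c * gint (n - c).
Proof.
move=> le_cn; have [b ->] : exists b, n = (b + c)%N by exists (n - c)%N; lia.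
by rewrite addnK (gintD _ (b + c) c) (gintD _ b c) exprD; ring.
Qed.

Lemma gint_swap a b : gint a + q ^+ a * gint b = gint b + q ^+ b * gint a.
Proof. by rewrite -!gintD addnC. Qed.

(** If a is divisible by 6 and b by 3, then the summands on the right are
    multiples of [6] and of [2][3]. *)
Lemma gint_split_up a b : gint (a + b) * (1 + q ^+ a.+1) =
  gint a * (1 + q ^+ (a + b).+1) + q ^+ a * (gint 2 * gint b).
Proof.
have E := gint_swap a b; rewrite gintD gint2 !exprS exprD.
have -> : gint a * (1 + q * (q ^+ a * q ^+ b)) =
  gint a + q * q ^+ a * (gint b + q ^+ b * gint a) - q * q ^+ a * gint b by ring.
by rewrite -E; ring.
Qed.

(** The counterpart of gint_split_up for c + 1 divisible by 6. *)
Lemma gint_split_down c b : gint (c.+1 + b) * (1 + q ^+ c) =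
  gint c.+1 * (1 + q ^+ (c + b)) + q ^+ c * (gint 2 * gint b).
Proof.
have E := gint_swap c.+1 b; rewrite gintD gint2 !exprD; move: E.
rewrite !exprS; set x := gint c.+1 => E.
have -> : x * (1 + q ^+ c * q ^+ b) =
  x + q ^+ c * (gint b + q ^+ b * x) - q ^+ c * gint b by ring.
by rewrite -E; ring.
Qed.

(** The denominator of K(k) is at most [2] unless 3 divides k, and y may supply
    the [3].  In the remaining case, 3 divides n and k, and the residue of c
    modulo 6, which is 1, 3 or 5, decides how [n] (1 + q^c) is regrouped. *)
Lemma N_odd_gint_mul n c k (y : F) : odd n -> odd c -> (c < n)%N -> N y ->
  weight_claim k ->
  (~~ ((3 %| k) && (3 %| n))%N -> N (gint 2 * weight k * y)) ->
  N (gint n * (1 + q ^+ c) * (weight k * y)).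
Proof.
move=> odd_n odd_c lt_cn Ny claim Ntwo.
have dvd2 m : (2 %| m)%N -> N (gint 2 * weight k * y) -> N (gint m * (weight k * y)).
  move=> /gint_dvd[z Nz ->] N2.
  rewrite [X in N X](_ : _ = gint 2 * weight k * y * z); first exact: NM.
  ring.
have [/andP[k3 n3]|no] := boolP ((3 %| k) && (3 %| n))%N; last first.
  rewrite gint_mul_evenly 1?ltnW // mulrDl -mulrA.
  apply: ND; first by apply: dvd2 (Ntwo no); lia.
  by apply: NM (N_exp _ Nq) _; apply: dvd2 (Ntwo no); lia.
move: claim; rewrite /weight_claim k3 => -[N23 N6].
have dvd6 m : (6 %| m)%N -> N (gint m * (weight k * y)).
  move=> /gint_dvd[z Nz ->].
  rewrite [X in N X](_ : _ = gint 6 * weight k * y * z); first exact: NM (NM N6 _) _.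
  ring.
have dvd3 m : (3 %| m)%N -> N (gint 2 * gint m * (weight k * y)).
  move=> /gint_dvd[z Nz ->].
  rewrite [X in N X](_ : _ = gint 2 * gint 3 * weight k * y * z); first exact: NM (NM N23 _) _.
  ring.
have [u nE] : exists u, n = (6 * u + 3)%N by exists ((n - 3) %/ 6)%N; lia.
have : exists v, [\/ c = (6 * v + 1)%N, c = (6 * v + 3)%N | c = (6 * v + 5)%N].
  exists (c %/ 6)%N; have : (c %% 6 < 6)%N by rewrite ltn_mod.
  move=> h; case: (boolP (c %% 6 == 1)%N) => c1; first by constructor 1; lia.
  case: (boolP (c %% 6 == 3)%N) => c3; first by constructor 2; lia.
  constructor 3; lia.
have Ne i : N (q ^+ i) by apply: N_exp.
have N1e i : N (1 + q ^+ i) by apply: ND.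
case=> v [] cE.
- have -> : gint n * (1 + q ^+ c) = gint (c - 1) * (1 + q ^+ (c - 1 + (n - c).+1).+1)
      + q ^+ (c - 1) * (gint 2 * gint (n - c).+1).
    by rewrite -gint_split_up; congr (gint _ * (1 + q ^+ _)); lia.
  rewrite mulrDl; apply: ND.
    by rewrite mulrAC; apply: NM => //; apply: dvd6; lia.
  by rewrite -mulrA; apply: NM => //; apply: dvd3; lia.
- rewrite gint_mul_evenly 1?ltnW // mulrDl -mulrA.
  by apply: ND; [|apply: NM => //]; apply: dvd6; lia.
- have -> : gint n * (1 + q ^+ c) = gint c.+1 * (1 + q ^+ (c + (n - c.+1)))
      + q ^+ c * (gint 2 * gint (n - c.+1)).
    by rewrite -gint_split_down; congr (gint _ * _); lia.
  rewrite mulrDl; apply: ND.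
    by rewrite mulrAC; apply: NM => //; apply: dvd6; lia.
  by rewrite -mulrA; apply: NM => //; apply: dvd3; lia.
Qed.

(** For odd n the factor [n] alone does not clear the denominator [2]; the
    Rogers-Szego sum has to help, through rogers_szegoS. *)
Lemma N_gTri n k : (4 <= n)%N -> (2 <= k)%N -> (2 * k <= n)%N -> N (gTri q n k).
Proof.
move=> hn h2 hk; have claim := N_weight h2.
have Ne i : N (q ^+ i) by apply: N_exp.
set G := gauss (n - 4) (n - 2 * k); have NG : N G by apply: N_gauss.
suff key : N (gint n * rogers_szego q (n - 2 * k) (q ^+ (n - 2)) * (weight k * G)).
  rewrite gTriE // /tri_summand gbinom_gauss // -/G.
  rewrite [X in N X](_ : _ = q ^+ (k * (k - 2)) * (gint n *
    rogers_szego q (n - 2 * k) (q ^+ (n - 2)) * (weight k * G))); first exact: NM.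
  ring.
have Ntwo := N_two_weight_binom h2 hk claim.
have dvdn_mul m : (if (3 %| k) && (3 %| n) then 3 %| m else true)%N ->
    N (gint m * (gint 2 * weight k * G)).
  case: ifP => [/andP[k3 n3] /gint_dvd[y Ny ->]|/negbT no _]; last first.
    by apply: NM (Ntwo no); apply: N_gint.
  move: claim; rewrite /weight_claim k3 => -[N23 _].
  rewrite [X in N X](_ : _ = gint 2 * gint 3 * weight k * G * y); last by ring.
  by apply: NM => //; apply: NM.
have [even_n|] := boolP (~~ odd n).
  rewrite mulrAC; apply: NM (N_rogers_szego _ _).
  have [/andP[k3 n3]|no] := boolP ((3 %| k) && (3 %| n))%N; last first.
    have [|y Ny ->] := @gint_dvd 2 n; first by lia.
    rewrite [X in N X](_ : _ = gint 2 * weight k * G * y); last by ring.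
    by apply: NM => //; apply: Ntwo.
  have [|y Ny ->] := @gint_dvd 6 n; first by lia.
  move: claim; rewrite /weight_claim k3 => -[_ N6].
  rewrite [X in N X](_ : _ = gint 6 * weight k * G * y); last by ring.
  by apply: NM => //; apply: NM.
rewrite negbK => odd_n.
have [t tE] : exists t, (n - 2 * k = t.+1)%N by exists (n - 2 * k).-1; lia.
rewrite tE rogers_szegoS big_distrr big_distrl /= big_nat.
apply: N_sum => j /andP[_ lt_jt].
have [odd_j|even_j] := boolP (odd j).
  have [||y Ny ->] := @gauss_dvd2 t j; [by lia | by []|].
  rewrite [X in N X](_ : _ = gint n * (gint 2 * weight k * G) * (y * (q ^+ (n - 2)) ^+ j *
    (q ^+ j + q ^+ (n - 2)))); last by ring.
  apply: NM; first by apply: dvdn_mul; case: ifP => // /andP[].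
  by apply: NM; [apply: NM => //; apply: N_exp | apply: ND].
have -> : q ^+ (n - 2) = q ^+ j * q ^+ (n - 2 - j).
  by rewrite -exprD; congr (_ ^+ _); lia.
rewrite [X in N X](_ : _ = gauss t j * (q ^+ j * q ^+ (n - 2 - j)) ^+ j * q ^+ j *
  (gint n * (1 + q ^+ (n - 2 - j)) * (weight k * G))); last by ring.
apply: NM; last by apply: N_odd_gint_mul => //; lia.
apply: NM => //; apply: NM; first exact: N_gauss.
by apply: N_exp; apply: NM.
Qed.

End Positivity.

(** * Values at roots of unity *)

Section GenericIdentities.

Variables (F : fieldType) (q : F).
Hypothesis gint_neq0 : forall m, (0 < m)%N -> gint q m != 0.

Lemma gbinom_sym m r : (r <= m)%N -> gbinom q m r = gbinom q m (m - r).
Proof.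
move=> le_rm; rewrite /gbinom le_rm leq_subr subKn //.
by rewrite [gfact q r * _]mulrC.
Qed.

Lemma gauss_absorb m r : gauss q m.+1 r.+1 * gint q r.+1 = gint q m.+1 * gauss q m r.
Proof.
have [lt_mr|le_rm] := ltnP m r; first by rewrite !gauss_small // mul0r mulr0.
rewrite -!gbinom_gauss // !gbinom_fact // subSS !gfactS.
have h1 := gfact_neq0 gint_neq0 r; have h2 := gfact_neq0 gint_neq0 (m - r).
have h3 := gint_neq0 (ltn0Sn r).
by field; rewrite h1 h2 h3.
Qed.

(** This form of the q-Catalan number has no denominator, so that it can be
    evaluated even where [m+1] vanishes. *)
Lemma gCatE m : gCat q m = gauss q (2 * m) m - q * gauss q (2 * m) m.+1.
Proof.
case: m => [|m].
  rewrite /gCat gint1 gbinom_gauss // muln0 !gauss0l.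
  by rewrite invr1 mul1r mulr0 subr0.
have h1 := gfact_neq0 gint_neq0 m; have h2 := gint_neq0 (ltn0Sn m).
have h3 := gint_neq0 (ltn0Sn m.+1).
rewrite /gCat -!gbinom_gauss // !gbinom_fact; try lia.
rewrite (_ : (2 * m.+1 - m.+1 = m.+1)%N); last lia.
rewrite (_ : (2 * m.+1 - m.+2 = m)%N); last lia.
rewrite (gfactS _ m.+1) (gfactS _ m); set T := gfact q (2 * m.+1).
have E : gint q m.+2 = 1 + q * gint q m.+1 by rewrite -(add1n m.+1) gintD gint1 expr1.
rewrite E in h3 *.
by field; rewrite h1 h2 h3.
Qed.

End GenericIdentities.

Section RootOfUnity.

Variables (K : numFieldType) (z : K) (e : nat).
Hypothesis z_prim : e.-primitive_root z.

Let e_gt0 : (0 < e)%N := prim_order_gt0 z_prim.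

Lemma expr_mul_prim i : z ^+ (e * i) = 1.
Proof. by rewrite exprM (prim_expr_order z_prim) expr1n. Qed.

Lemma gint_prim_eq0 m : ~~ (e %| m)%N -> gint z m != 0.
Proof.
move=> ndvd; apply: contraNneq ndvd => g0; rewrite (prim_order_dvd z_prim).
by rewrite -subr_eq0 subrX1 -/(gint z m) g0 mulr0.
Qed.

Lemma gint_prim_dvd m : (1 < e)%N -> gint z (e * m) = 0.
Proof.
move=> e_gt1; have : (z - 1) * gint z (e * m) = 0.
  by rewrite -subrX1 expr_mul_prim subrr.
move/eqP; rewrite mulf_eq0 => /orP[|/eqP//].
rewrite subr_eq0 -(expr1 z) -(prim_order_dvd z_prim) dvdn1; lia.
Qed.

Hypothesis gauss_prim : forall i, (0 < i < e)%N -> gauss z e i = 0.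

(** In the Vandermonde sum for e + a only the terms i = 0 and i = e survive. *)
Lemma gauss_prim_add a b :
  gauss z (e + a) b = gauss z a b + (if (e <= b)%N then gauss z a (b - e) else 0).
Proof.
rewrite gauss_Vandermonde big_ord_recl subn0 gauss0 mulr1 subn0 -mulnC mulnC.
rewrite expr_mul_prim mul1r; congr (_ + _).
case: leqP => [le_eb|lt_be]; last first.
  apply: big1 => i _; rewrite gauss_prim ?mulr0 ?mul0r //.
  by have := ltn_ord i; rewrite lift0; lia.
have lt_b : (e.-1 < b)%N by lia.
rewrite (bigD1 (Ordinal lt_b)) //= /bump /= add1n prednK //.
rewrite gaussnn subnn mul0n expr0 !mul1r big1 ?addr0 // => i ne.
have {}ne : (i.+1 != e)%N.
  by apply: contraNneq ne => E; rewrite -val_eqE /= -E.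
rewrite /bump /= add1n; have [lt_ie|] := ltnP i.+1 e; first by rewrite gauss_prim ?mulr0 ?mul0r.
by move=> le_ei; rewrite [gauss z e _]gauss_small ?mulr0 ?mul0r //; lia.
Qed.

Lemma gauss_Lucas u v a b : (a < e)%N -> (b < e)%N ->
  gauss z (u * e + a) (v * e + b) = 'C(u, v)%:R * gauss z a b.
Proof.
move=> lt_ae lt_be; elim: u v => [|u IH] v.
  rewrite mul0n add0n bin0n; case: v => [|v]; first by rewrite mul0n add0n mul1r.
  by rewrite gauss_small ?mul0r // mulSn; lia.
rewrite mulSn -addnA gauss_prim_add IH; case: v => [|v].
  by rewrite mul0n add0n leqNgt lt_be /= addr0 !bin0.
rewrite mulSn -addnA leq_addr addKn IH binS natrD mulrDl; congr (_ + _).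
Qed.

(** By gauss_prim_add, the sum doubles when t grows by one. *)
Lemma gauss_prim_sum y t : y ^+ e = 1 ->
  \sum_(0 <= j < (t * e).+1) y ^+ j * gauss z (t * e) j = 2 ^+ t.
Proof.
move=> ye; elim: t => [|t IH].
  by rewrite mul0n big_nat1 gauss0 mulr1 !expr0.
have -> : (t.+1 * e)%N = (e + t * e)%N by rewrite mulSn.
under eq_bigr do rewrite gauss_prim_add mulrDr.
rewrite big_split /= exprS mulr_natl mulr2n; congr (_ + _).
  rewrite (big_cat_nat _ (n := (t * e).+1)) //=; last lia.
  rewrite IH big_nat big1 ?addr0 // => j /andP[hj _].
  by rewrite gauss_small ?mulr0.
rewrite (big_cat_nat _ (n := e)) //=; last lia.
rewrite big_nat big1 ?add0r => [|j /andP[_ hj]]; last by rewrite leqNgt hj mulr0.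
rewrite -{1}[e]add0n big_addn (_ : ((e + t * e).+1 - e = (t * e).+1)%N); last lia.
rewrite -IH; apply: eq_bigr => j _.
by rewrite leq_addl addnK exprD ye mulr1.
Qed.

End RootOfUnity.

(** V x a says that x has the value a when z is substituted for q.  It is a
    relation since x need not be defined at z; the hypotheses are those of a
    place of F. *)
Section Values.

Variables (F : fieldType) (q : F) (K : numFieldType) (z : K) (e : nat).
Variable V : F -> K -> Prop.
Hypothesis gint_neq0 : forall m, (0 < m)%N -> gint q m != 0.
Hypothesis z_prim : e.-primitive_root z.
Hypotheses (V0 : V 0 0) (V1 : V 1 1) (Vq : V q z).
Hypothesis V_fun : forall x a b, V x a -> V x b -> a = b.
Hypothesis VD : forall x y a b, V x a -> V y b -> V (x + y) (a + b).
Hypothesis VB : forall x y a b, V x a -> V y b -> V (x - y) (a - b).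
Hypothesis VM : forall x y a b, V x a -> V y b -> V (x * y) (a * b).
Hypothesis Vdiv : forall x y a b, V x a -> V y b -> b != 0 -> V (x / y) (a / b).

Let e_gt0 : (0 < e)%N := prim_order_gt0 z_prim.

Lemma V_exp x a i : V x a -> V (x ^+ i) (a ^+ i).
Proof. by move=> Vx; elim: i => [|i IH]; rewrite ?expr0 // !exprS; apply: VM. Qed.

Lemma V_sum (I : Type) (r : seq I) (P : pred I) (f : I -> F) (g : I -> K) :
  (forall i, P i -> V (f i) (g i)) ->
  V (\sum_(i <- r | P i) f i) (\sum_(i <- r | P i) g i).
Proof. by move=> Vf; elim/big_ind2: _ => // *; apply: VD. Qed.

Lemma V_gint m : V (gint q m) (gint z m).
Proof. by apply: V_sum => i _; apply: V_exp. Qed.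

Lemma V_gauss m r : V (gauss q m r) (gauss z m r).
Proof.
elim: m r => [|m IH] [|r]; rewrite ?gauss0 ?gauss0l //.
by rewrite !gaussS; apply: VD => //; apply: VM => //; apply: V_exp.
Qed.

(** Compare the values of the two sides of gauss_absorb at m + 1 = e. *)
Lemma gauss_prim_eq0 i : (0 < i < e)%N -> gauss z e i = 0.
Proof.
move=> hi; have [i' [e' [iE eE]]] : exists i' e', i = i'.+1 /\ e = e'.+1.
  by exists i.-1, e.-1; lia.
have nz : gint z i != 0.
  by apply: (gint_prim_eq0 z_prim); apply/negP => /dvdn_leq; lia.
have e0 : gint z e = 0.
  by rewrite -[e]muln1 (gint_prim_dvd z_prim) //; lia.
have E := gauss_absorb gint_neq0 e' i'.
have := VM (V_gauss e i) (V_gint i); rewrite {1 2}eE {1 2}iE E => Vx.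
have := V_fun Vx (VM (V_gint e'.+1) (V_gauss e' i')).
by rewrite -eE e0 mul0r => /eqP; rewrite mulf_eq0 (negPf nz) orbF => /eqP.
Qed.

Lemma V_rogers_szego s x y : V x y ->
  V (rogers_szego q s x) (\sum_(0 <= j < s.+1) y ^+ j * gauss z s j).
Proof.
move=> Vx; apply: V_sum => j _; rewrite gbinom_gauss //.
by apply: VM (V_gauss _ _); apply: V_exp.
Qed.

Definition cat_value (m : nat) : K :=
  gauss z (2 * m) m - z * gauss z (2 * m) m.+1.

Lemma V_gCat m : V (gCat q m) (cat_value m).
Proof.
rewrite gCatE //; apply: VB; first exact: V_gauss.
by apply: VM => //; apply: V_gauss.
Qed.

Lemma gTri_rogers_szego n k : (2 <= k)%N -> (2 * k <= n)%N ->
  gTri q n k = q ^+ (k * (k - 2)) * (gint q n / gint q k) *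
    gauss q (n - 4) (n - 2 * k) * gCat q (k - 2) *
    rogers_szego q (n - 2 * k) (q ^+ (n - 2)).
Proof.
move=> hk hn; rewrite /gTri -(gbinom_gauss gint_neq0) gbinom_sym; last lia.
rewrite (_ : (n - 4 - (2 * k - 4) = n - 2 * k)%N); last lia.
by congr (_ * _); apply: eq_bigr => j _; rewrite -exprM mulnC.
Qed.

Lemma V_gTri_ndvd m k : (2 <= k)%N -> (2 * k <= e * m)%N -> ~~ (e %| k)%N ->
  V (gTri q (e * m) k) 0.
Proof.
move=> hk hn ndvd; rewrite gTri_rogers_szego //.
have e_gt1 : (1 < e)%N by case: e ndvd e_gt0 => [|[|e']] //; rewrite dvd1n.
have Vr : V (gint q (e * m) / gint q k) 0.
  rewrite -[0](mul0r (gint z k)^-1) -(gint_prim_dvd z_prim m e_gt1).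
  by apply: Vdiv; [exact: V_gint | exact: V_gint | exact: gint_prim_eq0 z_prim _ _].
have := VM (VM (VM (VM (V_exp (k * (k - 2)) Vq) Vr) (V_gauss (e * m - 4) (e * m - 2 * k)))
  (V_gCat (k - 2))) (V_rogers_szego (e * m - 2 * k) (V_exp (e * m - 2) Vq)).
by rewrite mulr0 !mul0r.
Qed.

(** The quotient [n]/[k] is 0/0 at z for e > 1; cancelling [e] leaves sums of
    m and c powers of z^e = 1. *)
Lemma V_gTri_dvd m c : (2 <= e * c)%N -> (2 * (e * c) <= e * m)%N ->
  V (gTri q (e * m) (e * c)) (m%:R / c%:R *
    'C((e * m - 4) %/ e, m - 2 * c)%:R * cat_value (e * c - 2) * 2 ^+ (m - 2 * c)).
Proof.
move=> hk hn; rewrite gTri_rogers_szego //.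
have c_gt0 : (0 < c)%N by move: hk; case: (c) => //; rewrite muln0.
have Vs b : V (\sum_(i < b) q ^+ (i * e)) b%:R.
  have -> : b%:R = \sum_(i < b) z ^+ (i * e) :> K.
    rewrite (eq_bigr (fun=> 1)) ?sumr_const ?card_ord // => i _.
    by rewrite mulnC (expr_mul_prim z_prim).
  by apply: V_sum => i _; apply: V_exp.
have Vr : V (gint q (e * m) / gint q (e * c)) (m%:R / c%:R).
  rewrite mulnC [(e * c)%N]mulnC !gint_mul -mulf_div divff ?gint_neq0 // mul1r.
  by apply: Vdiv => //; rewrite pnatr_eq0 -lt0n.
have sE : (e * m - 2 * (e * c) = (m - 2 * c) * e)%N by rewrite mulnBl; lia.
have Vb : V (gauss q (e * m - 4) (e * m - 2 * (e * c)))
    'C((e * m - 4) %/ e, m - 2 * c)%:R.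
  have := V_gauss (e * m - 4) (e * m - 2 * (e * c)).
  rewrite sE {2}(divn_eq (e * m - 4) e) -[((m - 2 * c) * e)%N]addn0.
  rewrite [gauss z _ _](gauss_Lucas z_prim gauss_prim_eq0) ?ltn_mod //.
  by rewrite gauss0 mulr1.
have Vh : V (rogers_szego q (e * m - 2 * (e * c)) (q ^+ (e * m - 2))) (2 ^+ (m - 2 * c)).
  have := V_rogers_szego (e * m - 2 * (e * c)) (V_exp (e * m - 2) Vq).
  rewrite sE (gauss_prim_sum z_prim gauss_prim_eq0) //.
  by rewrite exprAC (prim_expr_order z_prim) expr1n.
have := VM (VM (VM (VM (V_exp (e * c * (e * c - 2)) Vq) Vr) Vb) (V_gCat (e * c - 2))) Vh.
by rewrite -mulnA (expr_mul_prim z_prim) mul1r.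
Qed.

Lemma gauss_Lucas_eq x y u v a b : x = (u * e + a)%N -> y = (v * e + b)%N ->
  (a < e)%N -> (b < e)%N -> gauss z x y = 'C(u, v)%:R * gauss z a b.
Proof. by move=> -> -> ? ?; apply: (gauss_Lucas z_prim gauss_prim_eq0). Qed.

Lemma natr_eq_by_mul (T D X : nat) (x : K) : (0 < D)%N ->
  (T * D = X)%N -> x * D%:R = X%:R -> x = T%:R.
Proof.
move=> D_gt0 <- E; apply: (@mulIf _ D%:R); first by rewrite pnatr_eq0 -lt0n.
by rewrite E natrM.
Qed.

Lemma V_gTri_order1 n k (T : nat) : e = 1%N -> (2 <= k)%N -> (2 * k <= n)%N ->
  (T * ((n - 2 * k)`! * k`! * (k - 2)`!) = n * (n - 4)`! * 2 ^ (n - 2 * k))%N ->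
  V (gTri q (e * n) (e * k)) T%:R.
Proof.
move=> e1 hk hn hT; have := @V_gTri_dvd n k.
rewrite e1 !mul1n => /(_ hk hn); set x := (X in V _ X); suff -> : x = T%:R by [].
have z1 : z = 1 by rewrite -[z]expr1 -e1 (prim_expr_order z_prim).
have [d kE] : exists d, k = d.+2 by exists (k - 2)%N; lia.
have [s nE] : exists s, n = (2 * d + 4 + s)%N by exists (n - 2 * k)%N; lia.
apply: (natr_eq_by_mul _ hT); first by rewrite !muln_gt0 !fact_gt0.
rewrite /x divn1 /cat_value [X in X * gauss _ _ _]z1 mul1r {x hT}.
rewrite kE nE (_ : (2 * d + 4 + s - 2 * d.+2 = s)%N); last lia.
rewrite (_ : (2 * d + 4 + s - 4 = 2 * d + s)%N); last lia.
rewrite (_ : (d.+2 - 2 = d)%N); last lia.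
rewrite (@gauss_Lucas_eq _ _ (2 * d) d 0 0) ?(@gauss_Lucas_eq _ d.+1 (2 * d) d.+1 0 0);
  rewrite ?e1 ?muln1 ?addn0 // gauss0 !mulr1.
have B : ('C(2 * d + s, s) * (s`! * (2 * d)`!) = (2 * d + s)`!)%N.
  by rewrite -(bin_fact (leq_addl (2 * d) s)) addnK.
have C : ('C(2 * d, d) * (d`! * d`!) = (2 * d)`!)%N.
  rewrite -(@bin_fact (2 * d) d); last lia.
  by rewrite (_ : (2 * d - d = d)%N); last lia.
have C' : (d.+1 * 'C(2 * d, d.+1) = d * 'C(2 * d, d))%N.
  by rewrite mul_bin_left (_ : (2 * d - d = d)%N); last lia.
have E : d.+1%:R * ('C(2 * d, d)%:R - 'C(2 * d, d.+1)%:R) = 'C(2 * d, d)%:R :> K.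
  by rewrite mulrBr -!natrM C' mulSn natrD addrK.
have nz : (d.+2)%:R != 0 :> K by rewrite pnatr_eq0.
rewrite -B -C !factS !natrM natrX; move: E.
set u := 'C(2 * d, d)%:R; set w := 'C(2 * d, d.+1)%:R; set r := 'C(2 * d + s, s)%:R.
set M := (2 * d + 4 + s)%:R; set S := s`!%:R; set f := d`!%:R; set P := 2%:R ^+ s.
set d1 := d.+1%:R; set d2 := d.+2%:R in nz * => E.
clearbody d1 d2.
transitivity (M * r * S * f * f * P * (d1 * (u - w))); first by field.
by rewrite E; ring.
Qed.

Lemma V_gTri_order23 m c (T : nat) : (e == 2) || (e == 3) ->
  (1 <= c)%N -> (2 * c <= m)%N ->
  (T * ((m - 2 * c)`! * c`! * (c - 1)`!) = m * (m - 2)`! * 2 ^ (m - 2 * c))%N ->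
  V (gTri q (e * m) (e * c)) T%:R.
Proof.
move=> e23 hc hm hT; have [d cE] : exists d, c = d.+1 by exists c.-1; lia.
have [s mE] : exists s, m = (2 * d + 2 + s)%N by exists (m - 2 * c)%N; lia.
have /V_gTri_dvd : (2 <= e * c)%N by case/orP: e23 => /eqP->; lia.
have le_em : (2 * (e * c) <= e * m)%N by rewrite mulnCA leq_mul2l hm orbT.
move=> /(_ m le_em); set x := (X in V _ X); suff -> : x = T%:R by [].
apply: (natr_eq_by_mul _ hT); first by rewrite !muln_gt0 !fact_gt0.
have catE : cat_value (e * c - 2) = 'C(2 * d, d)%:R.
  rewrite /cat_value cE; case/orP: e23 => /eqP e_eq.
    rewrite [gauss z _ _.+1](@gauss_Lucas_eq _ _ (2 * d) d 0 1) ?e_eq //; try lia.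
    rewrite (@gauss_Lucas_eq _ _ (2 * d) d 0 0) ?e_eq //; try lia.
    by rewrite gauss0 gauss0l /= mulr0 mulr0 subr0 mulr1.
  rewrite [gauss z _ _.+1](@gauss_Lucas_eq _ _ (2 * d) d 2 2) ?e_eq //; try lia.
  rewrite (@gauss_Lucas_eq _ _ (2 * d) d 2 1) ?e_eq //; try lia.
  rewrite gaussnn [gauss z 2 1]gaussS gauss0 gaussnn expr1 mulr1 mulr1.
  by set u := _%:R; ring.
rewrite /x catE (_ : ((e * m - 4) %/ e = 2 * d + s)%N); last first.
  case/orP: e23 => /eqP->; rewrite mE; lia.
rewrite {hT x catE} cE mE (_ : (2 * d + 2 + s - 2 * d.+1 = s)%N); last lia.
rewrite (_ : (2 * d + 2 + s - 2 = 2 * d + s)%N); last lia.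
rewrite subn1 /=.
have B : ('C(2 * d + s, s) * (s`! * (2 * d)`!) = (2 * d + s)`!)%N.
  by rewrite -(bin_fact (leq_addl (2 * d) s)) addnK.
have C : ('C(2 * d, d) * (d`! * d`!) = (2 * d)`!)%N.
  rewrite -(@bin_fact (2 * d) d); last lia.
  by rewrite (_ : (2 * d - d = d)%N); last lia.
have nz : (d.+1)%:R != 0 :> K by rewrite pnatr_eq0.
rewrite -B -C !factS !natrM natrX; move: nz.
set u := 'C(2 * d, d)%:R; set r := 'C(2 * d + s, s)%:R.
set M := (2 * d + 2 + s)%:R; set S := s`!%:R; set f := d`!%:R; set P := 2%:R ^+ s.
set d1 := d.+1%:R => nz; clearbody d1.
by field.
Qed.

(** Both Gaussian coefficients in cat_value vanish by the q-Lucas theorem: modulo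
    e, the upper index 2(k-2) is e-4, the lower indices are e-2 and e-1. *)
Lemma V_gTri_order4 m c : (4 <= e)%N -> (1 <= c)%N -> (2 * c <= m)%N ->
  V (gTri q (e * m) (e * c)) 0.
Proof.
move=> e4 hc hm; have [d cE] : exists d, c = d.+1 by exists c.-1; lia.
have /V_gTri_dvd : (2 <= e * c)%N by rewrite cE mulnS; lia.
have le_em : (2 * (e * c) <= e * m)%N by rewrite mulnCA leq_mul2l hm orbT.
move=> /(_ m le_em); suff -> : cat_value (e * c - 2) = 0 by rewrite mulr0 mul0r.
have mE : (e * c - 2 = d * e + (e - 2))%N by rewrite cE mulnS; lia.
have mE' : ((e * c - 2).+1 = d * e + (e - 1))%N by rewrite cE mulnS; lia.
have mE2 : (2 * (e * c - 2) = (2 * d + 1) * e + (e - 4))%N.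
  by rewrite mE mulnDr mulnDl mulnA; lia.
rewrite /cat_value (gauss_Lucas_eq mE2 mE) ?(gauss_Lucas_eq mE2 mE'); try lia.
by rewrite !gauss_small ?mulr0 ?subr0 //; lia.
Qed.

End Values.

(** * Rational functions in q *)

(** A fraction p/r has a value wherever some denominator r does not vanish. *)
Section PartialEvaluation.

Variables (R : comPzRingType) (F K : fieldType).
Variables (iota : {rmorphism R -> F}) (ev : {rmorphism R -> K}).
Hypothesis iota_inj : injective iota.

Definition has_value (x : F) (a : K) : Prop :=
  exists p r : R, [/\ ev r != 0, x * iota r = iota p & a * ev r = ev p].

Lemma has_value_iota p : has_value (iota p) (ev p).
Proof. by exists p, 1; rewrite !rmorph1 !mulr1 oner_neq0. Qed.

Lemma ev_neq0_iota r : ev r != 0 -> iota r != 0.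
Proof.
by apply: contraNneq => r0; rewrite (iota_inj (etrans r0 (esym (rmorph0 iota)))) rmorph0.
Qed.

Lemma has_value_fun x a b : has_value x a -> has_value x b -> a = b.
Proof.
case=> p [r [nr xr ar]] [p' [r' [nr' xr' br']]].
have E : p * r' = p' * r.
  by apply: iota_inj; rewrite !rmorphM -xr -xr'; ring.
apply: (mulIf nr); apply: (mulIf nr'); rewrite ar -[ev p * _]rmorphM E rmorphM -br'.
by ring.
Qed.

Lemma has_valueD x y a b :
  has_value x a -> has_value y b -> has_value (x + y) (a + b).
Proof.
case=> p [r [nr xr ar]] [p' [r' [nr' yr' br']]]; exists (p * r' + p' * r), (r * r').
split; first by rewrite rmorphM mulf_neq0.
  by rewrite rmorphD !rmorphM -xr -yr'; ring.
by rewrite rmorphD !rmorphM -ar -br'; ring.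
Qed.

Lemma has_valueM x y a b :
  has_value x a -> has_value y b -> has_value (x * y) (a * b).
Proof.
case=> p [r [nr xr ar]] [p' [r' [nr' yr' br']]]; exists (p * p'), (r * r').
split; first by rewrite rmorphM mulf_neq0.
  by rewrite !rmorphM -xr -yr'; ring.
by rewrite !rmorphM -ar -br'; ring.
Qed.

Lemma has_valueB x y a b :
  has_value x a -> has_value y b -> has_value (x - y) (a - b).
Proof.
case=> p [r [nr xr ar]] [p' [r' [nr' yr' br']]]; exists (p * r' - p' * r), (r * r').
split; first by rewrite rmorphM mulf_neq0.
  by rewrite rmorphB !rmorphM -xr -yr'; ring.
by rewrite rmorphB !rmorphM -ar -br'; ring.
Qed.

Lemma has_value_div x y a b :
  has_value x a -> has_value y b -> b != 0 -> has_value (x / y) (a / b).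
Proof.
case=> p [r [nr xr ar]] [p' [r' [nr' yr' br']]] nb.
have np' : ev p' != 0 by rewrite -br' mulf_neq0.
have ny : y != 0.
  have := ev_neq0_iota np'; rewrite -yr'.
  by apply: contraNneq => ->; rewrite mul0r.
exists (p * r'), (r * p'); split; first by rewrite rmorphM mulf_neq0.
  by rewrite !rmorphM -xr -yr'; field.
by rewrite !rmorphM -ar -br'; field.
Qed.

End PartialEvaluation.

HB.instance Definition _ :=
  GRing.RMorphism.copy poly_ratfun (@FracField.tofrac {poly int}).

Lemma poly_ratfun_inj : injective poly_ratfun.
Proof. by move=> f g /eqP; rewrite /poly_ratfun tofrac_eq => /eqP. Qed.

Lemma qint_neq0 m : (0 < m)%N -> gint qvar m != 0.
Proof.
move=> m_gt0; have -> : gint qvar m = poly_ratfun (\sum_(i < m) 'X^i).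
  rewrite /gint rmorph_sum; apply: eq_bigr => i _.
  by rewrite [in RHS]rmorphXn.
rewrite -(rmorph0 poly_ratfun) (inj_eq poly_ratfun_inj).
apply/eqP => /(congr1 (fun p : {poly int} => p.[1])) /eqP.
rewrite horner_sum horner0 (eq_bigr (fun=> 1)) => [|i _].
  by rewrite sumr_const card_ord pnatr_eq0; move: m_gt0; case: (m).
by rewrite hornerXn expr1n.
Qed.

Definition nonneg_poly (x : ratfun) : Prop :=
  exists2 f : {poly int}, forall i, 0 <= f`_i & x = poly_ratfun f.

Lemma qTri_nonneg_poly n k : (4 <= n)%N -> (2 <= k)%N -> (2 * k <= n)%N ->
  nonneg_poly (qTri n k).
Proof.
apply: (N_gTri (q := qvar) (N := nonneg_poly) qint_neq0).
- by exists 0; rewrite ?rmorph0 // => i; rewrite coef0.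
- by exists 1; rewrite ?rmorph1 // => i; rewrite coef1; case: (i == 0).
- by exists 'X => // i; rewrite coefX; case: (i == 1)%N.
- move=> _ _ [f hf ->] [g hg ->]; exists (f + g); last by rewrite rmorphD.
  by move=> i; rewrite coefD addr_ge0.
- move=> _ _ [f hf ->] [g hg ->]; exists (f * g); last by rewrite rmorphM.
  by move=> i; rewrite coefM sumr_ge0 // => j _; rewrite mulr_ge0.
Qed.

Definition poly_eval (z : algC) : {rmorphism {poly int} -> algC} :=
  horner_morph (f := intr) (u := z) (fun a => mulrC _ _).

Definition ratfun_value (z : algC) : ratfun -> algC -> Prop :=
  has_value poly_ratfun (poly_eval z).

Lemma qTri_value (z : algC) e M k : e.-primitive_root z ->
  (4 <= e * M)%N -> (2 <= k)%N -> (2 * k <= e * M)%N ->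
  ratfun_value z (qTri (e * M) k) #|sym_tri (e * M) M k|%:R.
Proof.
move=> z_prim hn hk hkn.
have e_gt0 := prim_order_gt0 z_prim.
have V0 : ratfun_value z 0 0.
  by have := has_value_iota poly_ratfun (poly_eval z) 0; rewrite !rmorph0.
have V1 : ratfun_value z 1 1.
  by have := has_value_iota poly_ratfun (poly_eval z) 1; rewrite !rmorph1.
have Vq : ratfun_value z qvar z.
  have := has_value_iota poly_ratfun (poly_eval z) 'X.
  by rewrite /poly_eval /= /horner_morph map_polyX hornerX.
have Vf := has_value_fun poly_ratfun_inj (ev := poly_eval z).
have VD := @has_valueD _ _ _ poly_ratfun (poly_eval z).
have VB := @has_valueB _ _ _ poly_ratfun (poly_eval z).
have VM := @has_valueM _ _ _ poly_ratfun (poly_eval z).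
have Vd := has_value_div poly_ratfun_inj (ev := poly_eval z).
have M_gt0 : (0 < M)%N by move: hn; case: (M) => //; rewrite muln0.
have [/dvdnP[c kE]|ndvd] := boolP (e %| k)%N; last first.
  rewrite sym_tri_dvdn //.
  exact: (V_gTri_ndvd (V := ratfun_value z) qint_neq0 z_prim).
rewrite mulnC in kE; have c_gt0 : (0 < c)%N by move: hk; rewrite kE; case: (c) => //; rewrite muln0.
have cM : (2 * c <= M)%N by move: hkn; rewrite kE mulnCA leq_mul2l; case: eqP => // e0; lia.
rewrite kE; have [e1|] := eqVneq e 1%N.
  apply: (V_gTri_order1 (V := ratfun_value z) qint_neq0 z_prim) => //; try lia.
  have := @card_TRI_ears M c; rewrite e1 cM (_ : 1 < c)%N; last lia.
  by apply; lia.
have [e2 _|] := eqVneq e 2%N.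
  apply: (V_gTri_order23 (V := ratfun_value z) qint_neq0 z_prim) => //; try lia.
  have := @card_central_sym_TRI M c; rewrite e2 cM c_gt0.
  by apply; lia.
have [e3 _ _|] := eqVneq e 3%N.
  apply: (V_gTri_order23 (V := ratfun_value z) qint_neq0 z_prim) => //; try lia.
  have := @card_triple_sym_TRI M c; rewrite e3 cM c_gt0.
  by apply; lia.
move=> e3 e2 e1; have e4 : (3 < e)%N by lia.
rewrite no_highly_symmetric_TRI //.
exact: (V_gTri_order4 (V := ratfun_value z) qint_neq0 z_prim).
Qed.

Lemma cycle_rotX n j : (0 < n)%N ->
  <[(rot_vertices n ^+ j)%g]>%g = <[(rot_vertices n ^+ gcdn j n)%g]>%g.
Proof.
move=> n_gt0; set g := rot_vertices n.
apply/eqP; rewrite (eq_subG_cyclic (cycle_cyclic g)) ?cycleX //.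
rewrite -!/(order _) !orderXgcd order_rot //.
by rewrite [gcdn n (gcdn j n)]gcdnC -gcdnA gcdnn [gcdn j n]gcdnC.
Qed.

(** Being fixed by a rotation only depends on the cyclic group that it
    generates, so the number of its steps can be taken to divide n. *)
Lemma card_Fix_rotX n k j : (3 < n)%N ->
  #|'Fix_(TRI_ear n k | rot_action n)[(rot_vertices n ^+ j)%g]%g| =
  #|sym_tri n (gcdn j n) k|.
Proof.
move=> hn; rewrite -afix_cycle cycle_rotX ?afix_cycle; last lia.
apply: eq_card => D; rewrite inE; apply/andP/setIdP.
  by case=> /setIdP[triD earD] /afix1P ->; rewrite eqxx -card_ears.
case=> triD /andP[/eqP fixD earD]; split; last exact/afix1P.
by apply/setIdP; rewrite card_ears.
Qed.

(** Negative powers are positive ones, since both g^n and z^n are trivial. *)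
Lemma expgz_nat n (z : algC) (d : int) : (0 < n)%N -> n.-primitive_root z ->
  exists j, expgz (rot_vertices n) d = (rot_vertices n ^+ j)%g /\ z ^ d = z ^+ j.
Proof.
move=> n_gt0 z_prim; case: d => m; first by exists m.
have nE : (m.+1 + n.-1 * m.+1 = n * m.+1)%N by rewrite -mulSn prednK.
exists (n.-1 * m.+1)%N; split.
  apply: (mulgI (rot_vertices n ^+ m.+1)%g); rewrite /= mulgV -expgD nE.
  by rewrite expgM rot_expn expg1n.
have nz : z ^+ m.+1 != 0.
  by rewrite expf_neq0 // (prim_root_eq0 z_prim) -lt0n.
apply: (mulfI nz); rewrite -exprD nE exprM (prim_expr_order z_prim) expr1n.
exact: divff.
Qed.

Theorem theorem6 (n : nat) (hn : (4 <= n)%N) :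
  \sum_(2 <= k < n.+1 | (2 * k <= n)%N) qTri n k = qCat (n - 2)
  /\
  (forall k : nat, (2 <= k)%N -> (2 * k <= n)%N ->
     exists f : {poly int},
       poly_ratfun f = qTri n k
       /\ cyclic_sieving (TRI_ear n k) (rot_action n) (rot_vertices n) n f).
Proof.
have n_gt0 : (0 < n)%N by lia.
split; first exact: (gTri_sum qint_neq0 hn).
move=> k hk hkn; have [f f_ge0 fE] := qTri_nonneg_poly hn hk hkn.
exists f; split; first by rewrite fE.
split; [exact: order_rot | exact: TRI_ear_acts | exact: f_ge0 |].
move=> xi xi_prim d; have [j [-> ->]] := expgz_nat d n_gt0 xi_prim.
rewrite card_Fix_rotX //.
apply: (has_value_fun poly_ratfun_inj (ev := poly_eval (xi ^+ j)) (x := qTri n k)); last first.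
  by rewrite fE; apply: has_value_iota.
have z_prim := exp_prim_root xi_prim j.
have nE : (n %/ gcdn j n * gcdn j n = n)%N by rewrite divnK // dvdn_gcdr.
have := @qTri_value _ _ (gcdn j n) k z_prim; rewrite nE; exact.
Qed.
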